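(* Let $k\in\mathbb N$, let $\alpha,\beta^i,\gamma^i:\mathscr F^{sa}\to\mathscr F^{sa}$ ($i=1,\dots,k$), and suppose there is a constant $\bar L>0$ such that for all $U\in\mathscr F^{sa}$ $$\psi(U\alpha(U))+\frac k2\sum_{i=1}^k\|\beta^i(U)\|_2^2\,\|\gamma^i(U)\|_2^2\le-\bar L\|U\|_2^2 .$$ Let $\{U_t\}_{t\ge0}$ be a solution to the free SDE $\mathrm dU_t=\alpha(U_t)\,\mathrm dt+\sum_{i=1}^k\beta^i(U_t)\,\mathrm dW_t\,\gamma^i(U_t)$ with initial value $U_0\in\mathscr F^{sa}$. Then there exists a constant $C'>0$ such that for all $t\ge0$ $$\|U_t\|_2^2\le e^{-C't}\|U_0\|_2^2 .$$
   Context: $(\mathscr F,\psi)$ is a non-commutative probability space: a von Neumann algebra $\mathscr F$ with a faithful unital normal trace $\psi$. $\mathscr F^{sa}$ is the set of self-adjoint elements, $\|\cdot\|$ the operator norm, $\|U\|_2=\psi(|U|^2)^{1/2}$ with $|U|=(U^*U)^{1/2}$. $\{W_t\}_{t\ge0}\subset\mathscr F^{sa}$ is a free Brownian motion: $W_0=0$; for $0\le s<t$ the increment $W_t-W_s$ is freely independent from $\mathscr W_s$, the von Neumann algebra generated by $\{W_\tau:0\le\tau\le s\}$; and $W_t-W_s$ has the semicircular distribution of mean $0$ and variance $t-s$. A process $U_t$ is adapted if $U_t\in\mathscr W_t$ for all $t$. For $\beta_t,\gamma_t\in\mathscr W_t$ with $\|\beta_t\|\|\gamma_t\|\in L^2([0,T])$,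 the free stochastic integral $\int_0^T\beta_t\,\mathrm dW_t\,\gamma_t$ is the operator-norm limit of $\sum_i\beta_{t_{i-1}}(W_{t_i}-W_{t_{i-1}})\gamma_{t_{i-1}}$ as the mesh of the partition tends to $0$. Convention on coefficients: $\alpha,\beta^i,\gamma^i$ map $\mathscr F^{sa}\cap\mathscr W_t$ into $\mathscr W_t$ for every $t$. A solution $\{U_t\}_{t\ge0}$ of the free SDE is an adapted family in $\mathscr F^{sa}$ such that for every $T>0$: $\|\alpha(U_t)\|\in L^1([0,T])$, $\|\beta^i(U_t)\|\|\gamma^i(U_t)\|\in L^2([0,T])$, and $U_t=U_0+\int_0^t\alpha(U_s)\,\mathrm ds+\sum_{i=1}^k\int_0^t\beta^i(U_s)\,\mathrm dW_s\,\gamma^i(U_s)$ for all $t\in[0,T]$. *)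

(* Defs.v *)
From HB Require Import structures.
From mathcomp Require Import all_boot all_order all_algebra.
From mathcomp Require Import all_classical all_reals all_analysis.
From mathcomp Require Import complex.

Set Implicit Arguments.
Unset Strict Implicit.
Unset Printing Implicit Defensive.

Import Order.TTheory GRing.Theory Num.Theory.
Import numFieldNormedType.Exports.

Local Open Scope classical_set_scope.
Local Open Scope ring_scope.
Local Open Scope complex_scope.

Record hilbertSpace (R : realType) := HilbertSpace {
  hs_sort :> completeNormedModType R[i] ;
  hs_dot : {dot hs_sort for (Num.conj : R[i] -> R[i])} ;
  hs_normE : forall x : hs_sort, `|x| ^+ 2 = hs_dot x x }.

Section Operators.
Context {R : realType} {H : hilbertSpace R}.

(* Operators are plain functions: sum, difference and scaling are the pointwise
   ones, multiplication is composition and the unit is idfun. Boundedness is a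
   predicate. *)
Let op := H -> H.
Implicit Types (A B : op) (M S : set op).

Definition bounded_op A := linear A /\ continuous A.

(* Only meaningful for bounded A: sup takes the value 0 on unbounded sets. *)
Definition opnorm A : R :=
  sup [set complex.Re `|A x| | x in [set x : H | `|x| <= 1]].

Definition is_adjoint A B := forall x y : H, hs_dot H (A x) y = hs_dot H x (B y).

Definition adj A : op := xget 0 [set B | is_adjoint A B].

Definition op_le A B := forall x : H, 0 <= hs_dot H ((B - A) x) x.

Record star_subalgebra M : Prop := StarSubalgebra {
  star_bounded : M `<=` bounded_op ;
  star_one : M idfun ;
  star_lin : forall (a : R[i]) A B, M A -> M B -> M (a *: A + B) ;
  star_mul : forall A B, M A -> M B -> M (A \o B) ;
  star_adj : forall A, M A -> exists2 B, M B & is_adjoint A B }.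

Definition commutant S : set op :=
  [set A | bounded_op A /\ forall B, S B -> A \o B = B \o A].

Definition von_neumann_algebra M :=
  star_subalgebra M /\ commutant (commutant M) = M.

Definition star_generated S : set op :=
  \bigcap_(M in [set M | star_subalgebra M /\ S `<=` M]) M.

Definition vn_generated S : set op :=
  \bigcap_(M in [set M | von_neumann_algebra M /\ S `<=` M]) M.

Definition self_adjoint_part M : set op := [set A | M A /\ is_adjoint A A].

Definition is_supremum_in M S A :=
  [/\ self_adjoint_part M A,
      forall B, S B -> op_le B A
    & forall B, self_adjoint_part M B ->
        (forall C, S C -> op_le C B) -> op_le A B].

(* Compatibility with suprema of (bounded) increasing nets, a net being replaced
   by the upward directed set of its values. *)
Definition normal_functional M (phi : op -> R[i]) :=
  forall (S : set op) A, S !=set0 -> S `<=` self_adjoint_part M ->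
    (forall B C, S B -> S C -> exists D, [/\ S D, op_le B D & op_le C D]) ->
    is_supremum_in M S A ->
    complex.Re (phi A) = sup [set complex.Re (phi B) | B in S].

End Operators.

(* ncp_trace is only constrained on the algebra ncp_alg. *)
Record ncProbSpace (R : realType) := NcProbSpace {
  ncp_hilbert : hilbertSpace R ;
  ncp_alg : set (ncp_hilbert -> ncp_hilbert) ;
  ncp_trace : (ncp_hilbert -> ncp_hilbert) -> R[i] ;
  ncp_vn : von_neumann_algebra ncp_alg ;
  ncp_linear : forall (a : R[i]) A B, ncp_alg A -> ncp_alg B ->
    ncp_trace (a *: A + B) = a * ncp_trace A + ncp_trace B ;
  ncp_unital : ncp_trace idfun = 1 ;
  ncp_positive : forall A, ncp_alg A -> 0 <= ncp_trace (adj A \o A) ;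
  ncp_faithful : forall A, ncp_alg A -> ncp_trace (adj A \o A) = 0 -> A = 0 ;
  ncp_tracial : forall A B, ncp_alg A -> ncp_alg B ->
    ncp_trace (A \o B) = ncp_trace (B \o A) ;
  ncp_normal : normal_functional ncp_alg ncp_trace }.

Definition ncp_op {R : realType} (P : ncProbSpace R) : Type :=
  ncp_hilbert P -> ncp_hilbert P.

Section FreeProbability.
Context {R : realType} {P : ncProbSpace R}.
Local Notation op := (ncp_hilbert P -> ncp_hilbert P).
Local Notation psi := (@ncp_trace R P).

Definition ncp_sa : set op := self_adjoint_part (@ncp_alg R P).

(* |A| = (A^* A)^(1/2), so psi(|A|^2) is psi(A^* A), a nonnegative real. *)
Definition norm2 (A : op) : R := Num.sqrt (complex.Re (psi (adj A \o A))).

Definition freely_independent (I : eqType) (M : I -> set op) :=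
  forall (n : nat) (i : 'I_n -> I) (A : 'I_n -> op), (0 < n)%N ->
    (forall j, M (i j) (A j) /\ psi (A j) = 0) ->
    (forall j l : 'I_n, l = j.+1 :> nat -> i j != i l) ->
    psi (\big[(fun B C : op => B \o C)/idfun]_(j < n) A j) = 0.

Definition free_from (A : op) (M : set op) :=
  freely_independent
    (fun b : bool => if b then star_generated [set A] else M).

Definition semicircle_pdf (m v x : R) : R :=
  Num.sqrt (4 * v - (x - m) ^+ 2) / (2 * pi * v).

(* The law of a self-adjoint A is the compactly supported probability measure on
   the line with moments psi(A^n). *)
Definition semicircular (m v : R) (A : op) :=
  forall n : nat, psi (iter n A) =
    (\int[lebesgue_measure]_(x in `[m - 2 * Num.sqrt v, m + 2 * Num.sqrt v])
       (x ^+ n * semicircle_pdf m v x))%:C.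

Definition filtration (W : R -> op) (t : R) : set op :=
  vn_generated [set W s | s in `[0, t]].

(* Processes indexed by [0, +oo[ are functions on R whose values at negative
   times are ignored. *)
Record free_brownian_motion (W : R -> op) : Prop := FreeBrownianMotion {
  fbm_sa : forall t, 0 <= t -> ncp_sa (W t) ;
  fbm_0 : W 0 = 0 ;
  fbm_free : forall s t, 0 <= s -> s < t ->
    free_from (W t - W s) (filtration W s) ;
  fbm_semicircular : forall s t, 0 <= s -> s < t ->
    semicircular 0 (t - s) (W t - W s) }.

(* Lebesgue (not just Borel) measurability is the one for the completed
   measure. *)
Local Notation leb := (@completed_lebesgue_measure R).

Definition mem_Lp (p : \bar R) (T : R) (f : R -> R) :=
  (f \_ `[0, T] : _ -> R) \in Lfun leb p.

Record simple_function (D : set R) := SimpleFunction {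
  sf_size : nat ;
  sf_set : 'I_sf_size -> set R ;
  sf_val : 'I_sf_size -> op ;
  sf_measurable : forall j,
    measurable (sf_set j : set (caratheodory_type (wlength idfun)^*%mu)) ;
  sf_sub : forall j, sf_set j `<=` D ;
  sf_alg : forall j, ncp_alg (sf_val j) }.

Global Arguments sf_set {D} s j.
Global Arguments sf_val {D} s j.

Definition sf_eval D (s : simple_function D) (x : R) : op :=
  \sum_(j < sf_size s) (\1_(sf_set s j) x : R)%:C *: sf_val s j.

Definition sf_integral D (s : simple_function D) : op :=
  \sum_(j < sf_size s) (fine (leb (sf_set s j)))%:C *: sf_val s j.

(* Bochner integral over [0, t] for the operator norm. As in is_stoch_integral,
   A is required to lie in the algebra, hence to be bounded, since opnorm is not
   meaningful on unbounded maps. *)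
Definition is_bochner_integral (t : R) (f : R -> op) (A : op) :=
  ncp_alg A /\
  exists s : nat -> simple_function `[0, t],
    [/\ forall n, measurable_fun
          (`[0, t] : set (caratheodory_type (wlength idfun)^*%mu))
          (fun x => opnorm (f x - sf_eval (s n) x)),
        (\int[leb]_(x in `[0%R, t]) (opnorm (f x - sf_eval (s n) x)%R)%:E)%E
          @[n --> \oo] --> 0%E
      & opnorm (sf_integral (s n) - A) @[n --> \oo] --> (0 : R)].

(* itv_partition 0 t p says that 0 = (0 :: p)_0 < ... < (0 :: p)_(size p) = t. *)
Definition stoch_sum (W b c : R -> op) (p : seq R) : op :=
  \sum_(i < size p) (b (0 :: p)`_i \o (W (0 :: p)`_i.+1 - W (0 :: p)`_i)
                       \o c (0 :: p)`_i).

Definition mesh_lt (p : seq R) (d : R) :=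
  forall i, (i < size p)%N -> (0 :: p)`_i.+1 - (0 :: p)`_i < d.

Definition is_stoch_integral (t : R) (W b c : R -> op) (A : op) :=
  ncp_alg A /\
  forall e : R, 0 < e -> exists2 d : R, 0 < d &
    forall p, itv_partition 0 t p -> mesh_lt p d ->
      opnorm (stoch_sum W b c p - A) < e.

Definition preserves_filtration (W : R -> op) (a : op -> op) :=
  forall t A, 0 <= t -> ncp_sa A -> filtration W t A -> filtration W t (a A).

Record free_sde_solution (k : nat) (W : R -> op) (alpha : op -> op)
    (beta gamma : 'I_k -> op -> op) (U : R -> op) : Prop := FreeSdeSolution {
  sol_sa : forall t, 0 <= t -> ncp_sa (U t) ;
  sol_adapted : forall t, 0 <= t -> filtration W t (U t) ;
  sol_drift : forall T, 0 < T ->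
    mem_Lp 1%E T (fun t => opnorm (alpha (U t))) ;
  sol_diffusion : forall i T, 0 < T ->
    mem_Lp 2%:E T (fun t => opnorm (beta i (U t)) * opnorm (gamma i (U t))) ;
  sol_eq : forall T, 0 < T -> forall t, t \in `[0, T] ->
    exists (A : op) (M : 'I_k -> op),
      [/\ is_bochner_integral t (fun s => alpha (U s)) A,
          forall i, is_stoch_integral t W
            (fun s => beta i (U s)) (fun s => gamma i (U s)) (M i)
        & U t = U 0 + A + \sum_(i < k) M i] }.

End FreeProbability.

(* Main.v *)
Require Import Defs.
From HB Require Import structures.
From mathcomp Require Import all_boot all_order all_algebra.
From mathcomp Require Import all_classical all_reals all_analysis.
From mathcomp Require Import measurable_realfun complex ring lra.

Set Implicit Arguments.
Unset Strict Implicit.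
Unset Printing Implicit Defensive.

Import Order.TTheory GRing.Theory Num.Theory.
Import numFieldNormedType.Exports.

Local Open Scope classical_set_scope.
Local Open Scope ring_scope.

(** Let [N t] be the squared L2 norm of [U t] and [L] the dissipativity constant.  The
    claim, with [C' = 2 L], is the integrated form of [N' <= - 2 L N], which Ito's
    formula suggests: the drift contributes [2 <U, alpha U>] and the stochastic
    integrals contribute at most [k] times the sum of the
    [||beta^i U||_2^2 ||gamma^i U||_2^2], by Cauchy-Schwarz over the [k] terms.

    The Ito isometry needed here is a computation with freeness.  An increment [D] of
    the Brownian motion is free from the past, centred and of variance its duration
    [v], so that [psi (X D Y D) = v psi(X) psi(Y)] for [X] and [Y] in the past
    ([tr_mul_free4]).  Hence [b D c] is orthogonal to the past and has squared norm
    [||b||_2^2 ||c||_2^2 v], and the squared norms of the terms of a Riemann sum add up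
    ([norm2_path_sum]).

    Time regularity is the delicate point, as the L2 norms of the diffusion coefficients
    may fail to be measurable in time.  Therefore their sum above, the diffusion
    density, is never integrated itself, only majorants [h] of it.  Since Riemann sums along all
    fine partitions converge to the stochastic integral, it is enough to find fine
    partitions along which the left Riemann sum of [h] hardly exceeds the integral of
    [h] ([good_partition]); they show that the stochastic part of [U y - U x] is
    orthogonal to [U x] with squared norm at most the integral of [h] over [`]x, y]]
    ([stoch_integral_increment]).  The drift is approximated by a simple function [s],
    uniformly over all subintervals, up to the integral of [||alpha U - s||]
    ([bochner_increment]).  Dissipativity then provides a majorant [h] in terms of [s]
    and of the value [U x] at the left endpoint, and the terms with [s] cancel in
    [N y - N x].  What remains is [N y <= (1 - 2 L (y - x)) N x] up to errors of
    arbitrarily small sum, and [discrete_decay] concludes. *)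

(** * Operators, traces and the L2 norm *)

Section Operators.
Context {R : realType} {H : hilbertSpace R}.
Implicit Types (A B C : H -> H) (M : set (H -> H)).

Lemma hs_dot_inj (u v : H) : (forall x, hs_dot H x u = hs_dot H x v) -> u = v.
Proof.
move=> h; apply/eqP; rewrite -subr_eq0; apply: contraT => uv0.
have := @neq0_dnorm_gt0 _ _ _ (hs_dot H) _ uv0.
by rewrite linearBr /= h subrr ltxx.
Qed.

Lemma is_adjoint_sym A B : is_adjoint A B -> is_adjoint B A.
Proof.
move=> h x y; rewrite hermitian_subproof [RHS]hermitian_subproof /=.
by rewrite h.
Qed.

Lemma adj_eq A B : is_adjoint A B -> adj A = B.
Proof.
move=> h; apply: xget_unique => // C hC; apply/funext => y.
by apply: hs_dot_inj => x; rewrite -h -hC.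
Qed.

Lemma is_adjoint_comp A A' B B' : is_adjoint A A' -> is_adjoint B B' ->
  is_adjoint (A \o B) (B' \o A').
Proof. by move=> hA hB x y /=; rewrite hA hB. Qed.

Lemma is_adjoint_lin (a : R[i]) A A' B B' : is_adjoint A A' -> is_adjoint B B' ->
  is_adjoint (a *: A + B) (Num.conj a *: A' + B').
Proof.
move=> hA hB x y /=.
rewrite /GRing.scale /GRing.add /=.
by rewrite linearDl linearDr /= linearZl_LR linearZr_LR /= hA hB conjCK.
Qed.

Lemma norm_complexE (x : H) : `|x| = (complex.Re `|x|)%:C%C.
Proof. by rewrite (RRe_real (ger0_real (normr_ge0 x))). Qed.

Lemma hs_norm_sqr (x : H) :
  hs_dot H x x = ((complex.Re `|x|) ^+ 2)%:C%C.
Proof. by rewrite -hs_normE norm_complexE /= !expr2 -rmorphM. Qed.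

Lemma Re_norm_ge0 (x : H) : 0 <= complex.Re `|x|.
Proof. by have := normr_ge0 x; rewrite {1}norm_complexE lecR. Qed.

Lemma opnorm_ge0 A : 0 <= opnorm A.
Proof.
have [h|/sup_out] := pselect (has_sup [set complex.Re `|A x| | x in [set x : H | `|x| <= 1]]).
  apply: le_trans (Re_norm_ge0 (A 0)) _; apply: ub_le_sup; first by case: h.
  by exists 0; rewrite //= normr0 ler01.
by rewrite /opnorm => ->.
Qed.

(** Continuity of a linear map bounds the set defining [opnorm], so that the
    supremum is a genuine one. *)
Lemma opnorm_bound A x : bounded_op A ->
  complex.Re `|A x| <= opnorm A * complex.Re `|x|.
Proof.
move=> [linA contA].
pose fA : {linear H -> H} := HB.pack A (GRing.isLinear.Build _ _ _ _ A linA).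
have A0 : A 0 = 0 by exact: (linear0 fA).
have AZ a y : A (a *: y) = a *: A y by have := linA a y 0; rewrite A0 !addr0.
have : has_sup [set complex.Re `|A x| | x in [set x : H | `|x| <= 1]].
  split; first by exists (complex.Re `|A 0|), 0 => //=; rewrite normr0 ler01.
  have /linear_bounded_continuous : continuous fA := contA.
  move=> /(@linear_boundedP _ _ _ fA)/pinfty_ex_gt0 [r r0 hr].
  exists (complex.Re r) => _ [y y1 <-].
  have : `|A y| <= r.
    apply: le_trans (hr y) _.
    by rewrite -[leRHS]mulr1 ler_wpM2l // ltW.
  have rE : r = (complex.Re r)%:C%C by rewrite (RRe_real (gtr0_real r0)).
  by rewrite {1}norm_complexE rE lecR.
move=> [_ ub].
have [->|x0] := eqVneq x 0; first by rewrite A0 normr0 /= mulr0.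
have nx : 0 < complex.Re `|x|.
  by rewrite lt_def Re_norm_ge0 andbT; apply: contra_neq x0 => h;
    apply/normr0_eq0; rewrite norm_complexE h.
have nxE : `|x| != 0 by rewrite normr_eq0.
rewrite -ler_pdivrMr //.
apply: ub_le_sup => //; exists (`|x|^-1 *: x).
  by rewrite /= normrZ normfV normr_id mulVf.
rewrite AZ normrZ normfV normr_id {1}norm_complexE {1}(norm_complexE (A x)).
by rewrite -fmorphV -rmorphM /= mulrC.
Qed.

Section StarAlgebra.
Context {M : set (H -> H)} (sM : star_subalgebra M).

Lemma star0 : M 0.
Proof.
have := star_lin sM (-1) (star_one sM) (star_one sM).
by rewrite scaleN1r addNr.
Qed.

Lemma starD A B : M A -> M B -> M (A + B).
Proof. by move=> hA hB; have := star_lin sM 1 hA hB; rewrite scale1r. Qed.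

Lemma starZ a A : M A -> M (a *: A).
Proof. by move=> hA; have := star_lin sM a hA star0; rewrite addr0. Qed.

Lemma starN A : M A -> M (- A).
Proof. by move=> hA; rewrite -scaleN1r; exact: starZ. Qed.

Lemma starB A B : M A -> M B -> M (A - B).
Proof. by move=> hA hB; apply: starD => //; exact: starN. Qed.

Lemma star_sum (I : Type) (r : seq I) (F : I -> H -> H) :
  (forall i, M (F i)) -> M (\sum_(i <- r) F i).
Proof.
move=> hF; apply: (big_ind M) => //; [exact: star0|exact: starD].
Qed.

Lemma adjP A : M A -> is_adjoint A (adj A).
Proof. by move=> /(star_adj sM)[B _ h]; rewrite (adj_eq h). Qed.

Lemma adj_star A : M A -> M (adj A).
Proof. by move=> /(star_adj sM)[B hB h]; rewrite (adj_eq h). Qed.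

Lemma adjK A : M A -> adj (adj A) = A.
Proof. by move=> /adjP/is_adjoint_sym/adj_eq. Qed.

Lemma adjD A B : M A -> M B -> adj (A + B) = adj A + adj B.
Proof.
move=> hA hB; apply: adj_eq => x y /=.
have -> : (A + B) x = A x + B x by [].
have -> : (adj A + adj B) y = adj A y + adj B y by [].
by rewrite linearDl linearDr /= (adjP hA) (adjP hB).
Qed.

Lemma adjZ a A : M A -> adj (a *: A) = Num.conj a *: adj A.
Proof.
move=> hA; apply: adj_eq; rewrite -[a *: A]addr0 -[_ *: adj A]addr0.
apply: is_adjoint_lin; first exact: adjP.
by move=> x y; rewrite linear0l linear0r.
Qed.

Lemma adj_comp A B : M A -> M B -> adj (A \o B) = adj B \o adj A.
Proof. by move=> hA hB; apply: adj_eq; apply: is_adjoint_comp; exact: adjP. Qed.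

Lemma adj_idfun : adj (idfun : H -> H) = idfun.
Proof. exact: adj_eq. Qed.

Lemma compDr A B C : M A -> A \o (B + C) = (A \o B) + (A \o C).
Proof.
move=> /(star_bounded sM)[linA _]; apply/funext => x /=.
by have := linA 1 (B x) (C x); rewrite !scale1r.
Qed.

Lemma compZr a A B : M A -> A \o (a *: B) = a *: (A \o B).
Proof.
move=> /(star_bounded sM)[linA _]; apply/funext => x /=.
have A0 : A 0 = 0.
  by have := linA (-1) 0 0; rewrite !scaleN1r oppr0 addr0 addNr.
by have := linA a (B x) 0; rewrite A0 !addr0.
Qed.

Lemma compDl A B C : (A + B) \o C = (A \o C) + (B \o C).
Proof. by []. Qed.

Lemma compZl a A B : (a *: A) \o B = a *: (A \o B).
Proof. by []. Qed.

End StarAlgebra.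

End Operators.

Section Algebra.
Context {R : realType} {P : ncProbSpace R}.
Local Notation op := (ncp_hilbert P -> ncp_hilbert P).
Local Notation alg := (@ncp_alg R P).
Local Notation psi := (@ncp_trace R P).
Implicit Types A B C V : op.

Let sP : star_subalgebra alg := (ncp_vn P).1.

Lemma alg0 : alg 0. Proof. exact: (star0 sP). Qed.
Lemma alg1 : alg idfun. Proof. exact: (star_one sP). Qed.
Lemma algD A B : alg A -> alg B -> alg (A + B). Proof. exact: (starD sP). Qed.
Lemma algZ a A : alg A -> alg (a *: A). Proof. exact: (starZ sP). Qed.
Lemma algN A : alg A -> alg (- A). Proof. exact: (starN sP). Qed.
Lemma algB A B : alg A -> alg B -> alg (A - B). Proof. exact: (starB sP). Qed.
Lemma algM A B : alg A -> alg B -> alg (A \o B). Proof. exact: (star_mul sP). Qed.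
Lemma alg_adj A : alg A -> alg (adj A). Proof. exact: (adj_star sP). Qed.
Lemma alg_sum (I : Type) (r : seq I) (F : I -> op) :
  (forall i, alg (F i)) -> alg (\sum_(i <- r) F i).
Proof. exact: (star_sum sP). Qed.

End Algebra.

Ltac solve_alg :=
  lazymatch goal with
  | |- ncp_alg (_ \o _) => apply: algM; solve_alg
  | |- ncp_alg (_ + _) => apply: algD; solve_alg
  | |- ncp_alg (- _) => apply: algN; solve_alg
  | |- ncp_alg (_ *: _) => apply: algZ; solve_alg
  | |- ncp_alg (adj _) => apply: alg_adj; solve_alg
  | |- ncp_alg (\sum_(_ <- _) _) => apply: alg_sum => ?; solve_alg
  | _ => first [done | exact: alg0 | exact: alg1]
  end.

Section TraceForm.
Context {R : realType} {P : ncProbSpace R}.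
Local Notation op := (ncp_hilbert P -> ncp_hilbert P).
Local Notation alg := (@ncp_alg R P).
Local Notation psi := (@ncp_trace R P).
Implicit Types A B C V : op.

Let sP : star_subalgebra alg := (ncp_vn P).1.

Lemma trD A B : alg A -> alg B -> psi (A + B) = psi A + psi B.
Proof. by move=> hA hB; have := ncp_linear 1 hA hB; rewrite scale1r mul1r. Qed.

Lemma tr0 : psi 0 = 0.
Proof. by apply: (addrI (psi 0)); rewrite -trD ?addr0//; solve_alg. Qed.

Lemma trZ a A : alg A -> psi (a *: A) = a * psi A.
Proof. by move=> hA; have := ncp_linear a hA alg0; rewrite tr0 !addr0. Qed.

Lemma trN A : alg A -> psi (- A) = - psi A.
Proof. by move=> hA; rewrite -scaleN1r trZ// mulN1r. Qed.

Lemma trB A B : alg A -> alg B -> psi (A - B) = psi A - psi B.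
Proof. by move=> hA hB; rewrite trD ?trN//; solve_alg. Qed.

(** Positivity makes the values of [psi] at [A^* A] and at [(1 + iA)^* (1 + iA)]
    real; the imaginary part of the second one is the difference of the two
    sides. *)
Lemma Re_tr_adj A : alg A -> complex.Re (psi (adj A)) = complex.Re (psi A).
Proof.
move=> hA; pose i : R[i] := 'i%C.
have hB : alg (idfun + i *: A) by solve_alg.
have hA' : alg (adj A) by solve_alg.
have := ncp_positive hB.
rewrite (adjD sP) ?(adjZ sP)//; [|solve_alg..].
rewrite adj_idfun (compDr sP) ?compDl; [|solve_alg].
rewrite ?compDl ?compZl !(compZr sP) ; [|solve_alg..].
have -> : (idfun : op) \o idfun = idfun by [].
have -> : adj A \o idfun = adj A by [].
have -> : (idfun : op) \o A = A by [].
have := ncp_positive hA.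
rewrite !trD ?trZ; [|solve_alg..].
have -> : Num.conj i = - i by apply/eqP; rewrite eq_complex /= oppr0 !eqxx.
rewrite ncp_unital lecE => /andP[/eqP h1 _]; rewrite lecE => /andP[/eqP + _].
move: h1 => /=.
case: (psi (adj A)) => a b; case: (psi A) => c d /=.
case: (psi _) => e f /= ->.
rewrite /i /=; simpc; lra.
Qed.

(** The real inner product of the Hilbert space L2(psi) underlying [norm2]. *)
Definition ip A B : R := complex.Re (psi (adj A \o B)).

Lemma ReD (x y : R[i]) : complex.Re (x + y) = complex.Re x + complex.Re y.
Proof. by case: x => a b; case: y. Qed.

Lemma ReN (x : R[i]) : complex.Re (- x) = - complex.Re x.
Proof. by case: x. Qed.

Lemma ReZ (r : R) (x : R[i]) : complex.Re (r%:C%C * x) = r * complex.Re x.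
Proof. by case: x => a b /=; rewrite mul0r subr0. Qed.

Lemma ipC A B : alg A -> alg B -> ip A B = ip B A.
Proof.
move=> hA hB; rewrite /ip -Re_tr_adj; last solve_alg.
by rewrite (adj_comp sP) ?(adjK sP)//; solve_alg.
Qed.

Lemma ipDr V A B : alg V -> alg A -> alg B -> ip V (A + B) = ip V A + ip V B.
Proof. by move=> hV hA hB; rewrite /ip (compDr sP) ?trD ?ReD//; solve_alg. Qed.

Lemma ipDl V A B : alg V -> alg A -> alg B -> ip (A + B) V = ip A V + ip B V.
Proof. by move=> *; rewrite ipC ?ipDr 1?(ipC (A := A)) 1?(ipC (A := B))//; solve_alg. Qed.

Lemma ipZr (r : R) V A : alg V -> alg A -> ip V (r%:C%C *: A) = r * ip V A.
Proof. by move=> hV hA; rewrite /ip (compZr sP) ?trZ ?ReZ//; solve_alg. Qed.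

Lemma ipZl (r : R) V A : alg V -> alg A -> ip (r%:C%C *: A) V = r * ip A V.
Proof. by move=> hV hA; rewrite ipC ?ipZr 1?ipC//; solve_alg. Qed.

Lemma ipNr V A : alg V -> alg A -> ip V (- A) = - ip V A.
Proof. by move=> hV hA; rewrite /ip -scaleN1r (compZr sP) ?trZ ?mulN1r ?ReN//; solve_alg. Qed.

Lemma ipNl V A : alg V -> alg A -> ip (- A) V = - ip A V.
Proof. by move=> hV hA; rewrite ipC ?ipNr 1?ipC//; solve_alg. Qed.

Lemma ipBr V A B : alg V -> alg A -> alg B -> ip V (A - B) = ip V A - ip V B.
Proof. by move=> *; rewrite ipDr ?ipNr//; solve_alg. Qed.

Lemma ipBl V A B : alg V -> alg A -> alg B -> ip (A - B) V = ip A V - ip B V.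
Proof. by move=> *; rewrite ipDl ?ipNl//; solve_alg. Qed.

Lemma ip0r V : alg V -> ip V 0 = 0.
Proof. by move=> hV; have := ipNr hV alg0; rewrite oppr0; lra. Qed.

Lemma ip_sumr (I : Type) (r : seq I) (F : I -> op) V : alg V ->
  (forall i, alg (F i)) -> ip V (\sum_(i <- r) F i) = \sum_(i <- r) ip V (F i).
Proof.
move=> hV hF; elim: r => [|i r IH]; first by rewrite !big_nil ip0r.
by rewrite !big_cons ipDr ?IH//; solve_alg.
Qed.

Lemma ip_ge0 A : alg A -> 0 <= ip A A.
Proof. by move=> /ncp_positive; rewrite lecE => /andP[]. Qed.

Lemma norm2_ge0 A : 0 <= norm2 A. Proof. exact: sqrtr_ge0. Qed.

Lemma norm2_sqr A : alg A -> norm2 A ^+ 2 = ip A A.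
Proof. by move=> hA; rewrite sqr_sqrtr// ip_ge0. Qed.

(** Cauchy-Schwarz. *)
Lemma ip_norm2 V A : alg V -> alg A -> `|ip V A| <= norm2 V * norm2 A.
Proof.
move=> hV hA; rewrite -(@ler_pXn2r _ 2)// ?nnegrE ?mulr_ge0 ?norm2_ge0//.
rewrite real_normK ?num_real// exprMn !norm2_sqr//.
have q (r : R) : 0 <= ip V V - 2 * r * ip V A + r ^+ 2 * ip A A.
  have : alg (V - r%:C%C *: A) by solve_alg.
  move=> /ip_ge0; rewrite ipBl ?ipBr ?ipZl ?ipZr ?ipZr ?(ipC hA hV); [|solve_alg..].
  by congr (_ <= _); ring.
have := ip_ge0 hA; rewrite le_eqVlt => /predU1P[a0|a0].
  rewrite -a0 mulr0; case: (eqVneq (ip V A) 0) => [->|n0]; first by rewrite expr0n.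
  (* a null vector with nonzero product would make [q] negative far away *)
  have := q ((ip V V + 1) / (2 * ip V A)); rewrite -a0 mulr0 addr0.
  have -> : 2 * ((ip V V + 1) / (2 * ip V A)) * ip V A = ip V V + 1 by field.
  by rewrite opprD addrA subrr add0r oppr_ge0 ler10.
have := q (ip V A / ip A A).
have -> : ip V V - 2 * (ip V A / ip A A) * ip V A + (ip V A / ip A A) ^+ 2 * ip A A
   = (ip V V * ip A A - ip V A ^+ 2) / ip A A by field; rewrite gt_eqF.
by rewrite pmulr_lge0 ?invr_gt0// subr_ge0.
Qed.

Lemma norm2D A B : alg A -> alg B -> norm2 (A + B) <= norm2 A + norm2 B.
Proof.
move=> hA hB; rewrite -(@ler_pXn2r _ 2)// ?nnegrE ?addr_ge0 ?norm2_ge0//.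
have hAB : alg (A + B) by solve_alg.
rewrite norm2_sqr// ipDl ?ipDr ?(ipC hB hA)//; [|solve_alg..].
rewrite sqrrD !norm2_sqr//.
by have := ler_normlW (ip_norm2 hA hB); lra.
Qed.

Lemma norm2N A : alg A -> norm2 (- A) = norm2 A.
Proof.
move=> hA; rewrite /norm2 -/(ip (- A) (- A)) -/(ip A A) ipNl ?ipNr ?opprK//; solve_alg.
Qed.

Lemma norm2B A B : alg A -> alg B -> norm2 (A - B) <= norm2 A + norm2 B.
Proof. by move=> hA hB; rewrite -(norm2N hB) norm2D//; solve_alg. Qed.

Lemma norm20 : norm2 (0 : op) = 0.
Proof. by rewrite /norm2 -/(ip 0 0) ip0r ?sqrtr0//; solve_alg. Qed.

Lemma norm2_sum (I : Type) (r : seq I) (F : I -> op) :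
  (forall i, alg (F i)) -> norm2 (\sum_(i <- r) F i) <= \sum_(i <- r) norm2 (F i).
Proof.
move=> hF; elim: r => [|i r IH]; first by rewrite !big_nil norm20.
rewrite !big_cons; apply: le_trans (norm2D _ _) _; [solve_alg|solve_alg|].
by rewrite lerD2l.
Qed.

Lemma norm2Z (r : R) A : alg A -> norm2 (r%:C%C *: A) = `|r| * norm2 A.
Proof.
move=> hA; apply/eqP; rewrite -(@eqrXn2 _ 2)// ?mulr_ge0 ?norm2_ge0//.
rewrite norm2_sqr ?ipZl ?ipZr ?exprMn ?real_normK ?num_real ?norm2_sqr//; [|solve_alg..].
by rewrite mulrA expr2.
Qed.

(** A functional that is normal is monotone: a two-element chain is a directed
    set whose supremum is its larger element. *)
Lemma Re_tr_le A B : self_adjoint_part alg A -> self_adjoint_part alg B ->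
  op_le A B -> complex.Re (psi A) <= complex.Re (psi B).
Proof.
move=> hA hB AB.
have BB : op_le B B by move=> x; rewrite subrr linear0l.
have AA : op_le A A by move=> x; rewrite subrr linear0l.
have := @ncp_normal _ P [set A; B] B.
move=> ->; first 1 last.
- by exists A; left.
- by move=> C [->|->].
- by move=> C D hC hD; exists B; split; [right|case: hC => ->|case: hD => ->].
- split=> //; first by move=> C [->|->].
  by move=> C hC; apply; right.
apply: ub_le_sup; last by exists A => //; left.
exists (Num.max (complex.Re (psi A)) (complex.Re (psi B))) => _ [C [->|->] <-].
  by rewrite le_max lexx.
by rewrite le_max lexx orbT.
Qed.

(** The operator [||A||^2 - A^* A] is positive, and monotonicity of the trace
    applies to it without extracting a square root. *)
Lemma norm2_le_opnorm A : alg A -> norm2 A <= opnorm A.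
Proof.
move=> hA; have bA := star_bounded sP hA.
have opA0 := opnorm_ge0 A.
rewrite -(@ler_pXn2r _ 2)// ?nnegrE ?norm2_ge0//.
rewrite norm2_sqr//.
have -> : opnorm A ^+ 2 = complex.Re (psi ((opnorm A ^+ 2)%:C%C *: idfun)).
  by rewrite trZ ?ReZ ?ncp_unital ?mulr1//; solve_alg.
apply: Re_tr_le.
- split; first solve_alg.
  by have := is_adjoint_comp (is_adjoint_sym (adjP sP hA)) (adjP sP hA).
- split; first solve_alg.
  move=> x y; set c : R[i] := _%:C%C.
  have -> : (c *: (idfun : op)) x = c *: x by [].
  have -> : (c *: (idfun : op)) y = c *: y by [].
  have cR : Num.conj c = c by apply: conj_Creal; rewrite complex_real.
  by rewrite linearZl_LR linearZr_LR /= cR.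
move=> x.
have -> : ((opnorm A ^+ 2)%:C%C *: idfun - (adj A \o A)) x = (opnorm A ^+ 2)%:C%C *: x - adj A (A x) by [].
rewrite linearBl linearZl_LR /= (is_adjoint_sym (adjP sP hA)) !hs_norm_sqr.
rewrite -rmorphM -rmorphB lecR subr_ge0 -exprMn ler_pXn2r// ?nnegrE ?Re_norm_ge0 ?mulr_ge0 ?Re_norm_ge0//.
exact: opnorm_bound.
Qed.

End TraceForm.
(** * Moments of the semicircular law *)

Section Semicircle.
Context {R : realType}.

Lemma derivable_LRcontinuous (F : R -> R) (a b : R) :
  (forall x, derivable F x 1) -> derivable_oo_LRcontinuous F a b.
Proof.
move=> dF; have cF : continuous F.
  by move=> x; apply: differentiable_continuous; apply/derivable1_diffP.
split=> //; [apply: cvg_at_right_filter|apply: cvg_at_left_filter]; exact: cF.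
Qed.

Lemma Rintegral_FTC2 (f F : R -> R) (a b : R) : a < b -> continuous f ->
  (forall x : R, is_derive x (1 : R) F (f x)) ->
  \int[lebesgue_measure]_(x in `[a, b]) f x = F b - F a.
Proof.
move=> ab cf dF; rewrite /Rintegral (@continuous_FTC2 _ f F)//.
- exact: continuous_subspaceT.
- by apply: derivable_LRcontinuous => x; have [] := dF x.
- by move=> x _; rewrite derive1E; have := dF x => h; rewrite derive_val.
Qed.

(** The substitution x = 2 sqrt(v) sin(y) leads to integrands with antiderivatives
    that are differentiable up to the endpoints, unlike those involving arcsine. *)
Lemma semicircle_moment_trig (v : R) (n : nat) : 0 < v ->
  \int[lebesgue_measure]_(x in `[- (2 * Num.sqrt v), 2 * Num.sqrt v])
     (x ^+ n * semicircle_pdf 0 v x) =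
  \int[lebesgue_measure]_(y in `[- (pi / 2), pi / 2])
     ((2 * Num.sqrt v) ^+ n * (2 / pi) * (sin y ^+ n * cos y ^+ 2)).
Proof.
move=> v0; pose r : R := 2 * Num.sqrt v.
have r0 : 0 < r by rewrite mulr_gt0 ?sqrtr_gt0.
have rv : r ^+ 2 = 4 * v by rewrite exprMn sqr_sqrtr ?ltW//; ring.
have pi0 : 0 < (pi : R) := pi_gt0 R.
pose F (y : R) := r * sin y.
have dF (y : R) : is_derive y 1 F (r * cos y).
  rewrite /F; apply: is_derive_eq; rewrite /GRing.scale /=; ring.
have F'E : F^`()%classic = (fun y => r * cos y).
  by apply/funext => y; rewrite derive1E; have := dF y => h; rewrite derive_val.
have cF' : continuous F^`()%classic.
  rewrite F'E => y; apply: cvgM; first exact: cvg_cst.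
  exact: continuous_cos.
pose G (x : R) := x ^+ n * semicircle_pdf 0 v x.
have cG : continuous G.
  move=> x; apply: cvgM; first exact: exprn_continuous.
  apply: cvgM; last exact: cvg_cst.
  apply: (@continuous_comp _ _ _ (fun x : R => 4 * v - (x - 0) ^+ 2)).
    apply: cvgB; first exact: cvg_cst.
    apply: (@continuous_comp _ _ _ (fun x : R => x - 0) (fun x => x ^+ 2)).
      by apply: cvgB; [exact: cvg_id|exact: cvg_cst].
    exact: exprn_continuous.
  exact: sqrt_continuous.
have pp : - (pi / 2) <= pi / 2 :> R by rewrite -subr_ge0; lra.
have := @integration_by_substitution_increasing R F G (- (pi / 2)) (pi / 2) pp.
have -> : F (- (pi / 2)) = - r by rewrite /F sinN sin_pihalf mulrN1.
have -> : F (pi / 2) = r by rewrite /F sin_pihalf mulr1.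
rewrite /Rintegral => ->.
- congr fine; apply: eq_integral => y; rewrite inE /= in_itv/= => /andP[y1 y2].
  rewrite F'E; congr (_ %:E).
  have -> : ((G \o F) * (fun y : R => r * cos y)) y = G (F y) * (r * cos y) by [].
  rewrite /G /F /semicircle_pdf -/r.
  have cy : 0 <= cos y by apply: cos_ge0_pihalf; rewrite y1 y2.
  have -> : 4 * v - (r * sin y - 0) ^+ 2 = (r * cos y) ^+ 2.
    by rewrite -rv subr0 !exprMn cos2sin2; ring.
  rewrite sqrtr_sqr ger0_norm; last by rewrite mulr_ge0// ltW.
  have -> : v = r ^+ 2 / 4 by rewrite rv; field.
  rewrite exprMn; move: pi0; generalize (pi : R) => q q0.
  by field; rewrite !gt_eqF.
- move=> x y hx hy xy; rewrite ltr_pM2l//.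
  by rewrite ltr_sin.
- by move=> y _; exact: cF'.
- by apply/cvg_ex; exists (F^`()%classic (- (pi / 2))); apply: cvg_at_right_filter; exact: cF'.
- by apply/cvg_ex; exists (F^`()%classic (pi / 2)); apply: cvg_at_left_filter; exact: cF'.
- by apply: derivable_LRcontinuous => y; have [] := dF y.
- exact: continuous_subspaceT.
Qed.

Lemma continuous_sinXcosX (c : R) (n m : nat) :
  continuous (fun y : R => c * (sin y ^+ n * cos y ^+ m)).
Proof.
move=> y; apply: cvgM; first exact: cvg_cst.
apply: cvgM.
  apply: (@continuous_comp _ _ _ (@sin R) (fun x => x ^+ n)); first exact: continuous_sin.
  exact: exprn_continuous.
apply: (@continuous_comp _ _ _ (@cos R) (fun x => x ^+ m)); first exact: continuous_cos.
exact: exprn_continuous.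
Qed.

Lemma semicircle_mean (v : R) : 0 < v ->
  \int[lebesgue_measure]_(x in `[- (2 * Num.sqrt v), 2 * Num.sqrt v])
     (x ^+ 1 * semicircle_pdf 0 v x) = 0.
Proof.
move=> v0; rewrite semicircle_moment_trig//.
have pi0 : 0 < (pi : R) := pi_gt0 R.
set c : R := _ * (2 / pi).
have dF (y : R) : is_derive y (1 : R) (fun y : R => - (c / 3) * cos y ^+ 3)
    (c * (sin y ^+ 1 * cos y ^+ 2)).
  by apply: is_derive_eq; rewrite /GRing.scale /=; field.
rewrite (Rintegral_FTC2 _ _ dF).
- by rewrite cosN cos_pihalf subrr.
- by rewrite -subr_gt0; lra.
- exact: continuous_sinXcosX.
Qed.

Lemma semicircle_variance (v : R) : 0 < v ->
  \int[lebesgue_measure]_(x in `[- (2 * Num.sqrt v), 2 * Num.sqrt v])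
     (x ^+ 2 * semicircle_pdf 0 v x) = v.
Proof.
move=> v0; rewrite semicircle_moment_trig//.
have pi0 : 0 < (pi : R) := pi_gt0 R.
have -> : (2 * Num.sqrt v) ^+ 2 = 4 * v by rewrite exprMn sqr_sqrtr ?ltW//; ring.
set c : R := _ * (2 / pi).
(* sin^2 cos^2 = (1 - cos(4y)) / 8, and sin(4y) = 4 sin cos (1 - 2 sin^2) *)
have dF (y : R) : is_derive y (1 : R)
    (fun y : R => c * (y / 8 - sin y * cos y * (1 - 2 * sin y ^+ 2) / 8))
    (c * (sin y ^+ 2 * cos y ^+ 2)).
  apply: is_derive_eq; rewrite /GRing.scale /=.
  by have c2 := cos2sin2 y; field: c2.
rewrite (Rintegral_FTC2 _ _ dF).
- rewrite cosN sinN cos_pihalf /c !mulr0 !mul0r !subr0.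
  clear; move: (pi_gt0 R); generalize (pi : R) => q q0.
  by field; rewrite gt_eqF.
- by rewrite -subr_gt0; lra.
- exact: continuous_sinXcosX.
Qed.

End Semicircle.
(** * Free increments *)

Section FreeIncrement.
Context {R : realType} {P : ncProbSpace R}.
Local Notation op := (ncp_hilbert P -> ncp_hilbert P).
Local Notation alg := (@ncp_alg R P).
Local Notation psi := (@ncp_trace R P).
Context {M : set op} (sM : star_subalgebra M) (M_alg : M `<=` alg).
Context {D : op} {v : R} (v_gt0 : 0 < v) (D_sa : ncp_sa D)
  (D_free : free_from D M) (D_semi : semicircular 0 v D).
Implicit Types X Y b c V : op.

Let D_alg : alg D := D_sa.1.

Lemma tr_semicircular : psi D = 0.
Proof. by have := D_semi 1%N; rewrite sub0r add0r semicircle_mean. Qed.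

Lemma tr_semicircular_sqr : psi (D \o D) = v%:C%C.
Proof. by have := D_semi 2%N; rewrite sub0r add0r semicircle_variance. Qed.

Let gD : star_generated [set D] D.
Proof. by move=> N [_]; apply. Qed.

Let gDD : star_generated [set D] ((D \o D) - v%:C%C *: idfun).
Proof.
move=> N [sN ND]; have {}ND : N D by exact: ND.
apply: (starB sN); first exact: (star_mul sN).
by apply: (starZ sN); exact: (star_one sN).
Qed.

Let free2 X Y : M X -> psi X = 0 -> star_generated [set D] Y -> psi Y = 0 ->
  psi (X \o Y) = 0.
Proof.
move=> hX X0 hY Y0.
have := @D_free 2 (fun j => odd j) (fun j => nth 0 [:: X; Y] j) isT.
rewrite !big_ord_recl big_ord0 /=; apply.
  by case=> -[|[|//]] ? /=.
by case=> [a ha] [b hb] /= ->; rewrite /=; case: (odd a).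
Qed.

Let free4 X Y : M X -> psi X = 0 -> M Y -> psi Y = 0 ->
  psi (X \o D \o Y \o D) = 0.
Proof.
move=> hX X0 hY Y0.
have := @D_free 4 (fun j => odd j) (fun j => nth 0 [:: X; D; Y; D] j) isT.
rewrite !big_ord_recl big_ord0 /=; apply.
  by case=> -[|[|[|[|//]]]] ? /=; split => //; exact: tr_semicircular.
by case=> [a ha] [b hb] /= ->; rewrite /=; case: (odd a).
Qed.

(** Only the mean of [X] can contribute, and [D] is centred. *)
Lemma tr_mul_free X : M X -> psi (X \o D) = 0.
Proof.
move=> hX; have aX := M_alg hX; pose x := psi X.
have : psi ((X - x *: idfun) \o D) = 0.
  apply: free2 => //; last exact: tr_semicircular.
    by apply: (starB sM) => //; apply: (starZ sM); exact: (star_one sM).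
  by rewrite trB ?trZ ?ncp_unital ?mulr1 ?subrr//; solve_alg.
have -> : (X - x *: idfun) \o D = (X \o D) - x *: D by [].
by rewrite trB ?trZ ?tr_semicircular ?mulr0 ?subr0//; solve_alg.
Qed.

Let tr_mul_free_sqr X : M X -> psi X = 0 -> psi (X \o (D \o D)) = 0.
Proof.
move=> hX X0; have aX := M_alg hX.
have : psi (X \o ((D \o D) - v%:C%C *: idfun)) = 0.
  apply: free2 => //.
  by rewrite trB ?trZ ?ncp_unital ?tr_semicircular_sqr ?mulr1 ?subrr//; solve_alg.
have sP : star_subalgebra alg := (ncp_vn P).1.
rewrite -scaleNr (compDr sP)// (compZr sP)// trD ?trZ//; [|solve_alg..].
have -> : X \o idfun = X by [].
by rewrite X0 mulr0 addr0.
Qed.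

(** Centering both factors leaves only the product of the means: the mixed
    terms vanish by freeness, once the trace is rotated. *)
Lemma tr_mul_free4 X Y : M X -> M Y ->
  psi (X \o D \o Y \o D) = v%:C%C * (psi X * psi Y).
Proof.
move=> hX hY; have aX := M_alg hX; have aY := M_alg hY.
have sP : star_subalgebra alg := (ncp_vn P).1.
have center Z : M Z -> M (Z - psi Z *: idfun) /\ psi (Z - psi Z *: idfun) = 0.
  move=> hZ; have aZ := M_alg hZ; split.
    by apply: (starB sM) => //; apply: (starZ sM); exact: (star_one sM).
  by rewrite trB ?trZ ?ncp_unital ?mulr1 ?subrr//; solve_alg.
have [hX0 X00] := center _ hX; have [hY0 Y00] := center _ hY.
have XE : X = (X - psi X *: idfun) + psi X *: idfun by rewrite subrK.
have YE : Y = (Y - psi Y *: idfun) + psi Y *: idfun by rewrite subrK.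
rewrite {1}XE {1}YE; move: hX0 X00 hY0 Y00.
set X0 := X - _; set Y0 := Y - _ => hX0 X00 hY0 Y00.
clearbody X0 Y0; have aX0 := M_alg hX0; have aY0 := M_alg hY0.
have aXD : alg (X0 \o D) by solve_alg.
have -> : (X0 + psi X *: idfun) \o D \o (Y0 + psi Y *: idfun) \o D =
  (X0 \o D \o Y0 \o D) + psi Y *: (X0 \o (D \o D)) +
  psi X *: (D \o Y0 \o D) + (psi X * psi Y) *: (D \o D).
  have lin A (hA : alg A) a (u w : ncp_hilbert P) : A (a *: u + w) = a *: A u + A w.
    exact: (star_bounded sP hA).1.
  apply/funext => z.
  have addE (A B : op) u : (A + B) u = A u + B u by [].
  have sclE a (A : op) u : (a *: A) u = a *: A u by [].
  rewrite /= !(addE, sclE) /= [Y0 (D z) + _]addrC !(lin _ D_alg) !(lin _ aX0).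
  rewrite -scalerA [X in _ + X = _]scalerDr. by rewrite [LHS](AC (2*2) (2*1*4*3)).
rewrite !trD ?trZ ?free4 ?tr_mul_free_sqr// ?tr_semicircular_sqr; try solve_alg.
have -> : psi (D \o Y0 \o D) = 0.
  have -> : D \o Y0 \o D = D \o (Y0 \o D) by [].
  by rewrite ncp_tracial//; [exact: tr_mul_free_sqr|solve_alg].
by rewrite !mulr0 !add0r mulrC.
Qed.

(** Rotating [c] under the trace leaves one element of the past next to [D]. *)
Lemma ip_free_increment V b c : M V -> M b -> M c -> ip V (b \o D \o c) = 0.
Proof.
move=> hV hb hc; have aV := M_alg hV; have ab := M_alg hb; have ac := M_alg hc.
rewrite /ip.
have -> : adj V \o (b \o D \o c) = (adj V \o b \o D) \o c by [].
rewrite ncp_tracial//; last solve_alg.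
have -> : c \o (adj V \o b \o D) = (c \o (adj V \o b)) \o D by [].
rewrite tr_mul_free//; apply: (star_mul sM) => //; apply: (star_mul sM) => //.
exact: (adj_star sM).
Qed.

Lemma tr_adj_mul b : alg b -> psi (adj b \o b) = (norm2 b ^+ 2)%:C%C.
Proof.
move=> ab; rewrite norm2_sqr// /ip RRe_real//.
by apply: ger0_real; exact: ncp_positive.
Qed.

(** The isometry of the free stochastic integral on a single increment. *)
Lemma norm2_free_increment b c : M b -> M c ->
  norm2 (b \o D \o c) ^+ 2 = norm2 b ^+ 2 * norm2 c ^+ 2 * v.
Proof.
move=> hb hc; have ab := M_alg hb; have ac := M_alg hc.
have sP : star_subalgebra alg := (ncp_vn P).1.
rewrite norm2_sqr; last solve_alg.
rewrite /ip (adj_comp sP (A := b \o D) (B := c)) ?(adj_comp sP (A := b) (B := D)) //; [|solve_alg..].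
rewrite (adj_eq D_sa.2).
have -> : adj c \o (D \o adj b) \o (b \o D \o c) =
   (adj c \o D \o (adj b \o b) \o D) \o c by [].
rewrite ncp_tracial//; last solve_alg.
have -> : c \o (adj c \o D \o (adj b \o b) \o D) =
   (c \o adj c) \o D \o (adj b \o b) \o D by [].
rewrite tr_mul_free4; first last.
- by apply: (star_mul sM) => //; exact: (adj_star sM).
- by apply: (star_mul sM) => //; exact: (adj_star sM).
rewrite (ncp_tracial ac (alg_adj ac)) !tr_adj_mul// -!rmorphM /=.
by ring.
Qed.

End FreeIncrement.

(** * Riemann sums along a path *)

Section PathSum.
Context {R : realType} {V : nmodType}.
Implicit Types (F : R -> R -> V) (x : R) (p q : seq R).

(** Stepping from the left end matches the filtration: the first increment belongs
    to the past of all later ones. *)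
Fixpoint path_sum F x p : V :=
  if p is y :: q then F x y + path_sum F y q else 0.

Lemma path_sumE F x p :
  path_sum F x p = \sum_(i < size p) F (x :: p)`_i (x :: p)`_i.+1.
Proof.
elim: p x => [|y p IH] x; first by rewrite big_ord0.
by rewrite big_ord_recl /= IH.
Qed.

Lemma path_sum_cat F x p q :
  path_sum F x (p ++ q) = path_sum F x p + path_sum F (last x p) q.
Proof. by elim: p x => [|y p IH] x /=; rewrite ?add0r// IH addrA. Qed.

End PathSum.

Section BrownianSum.
Context {R : realType} {P : ncProbSpace R}.
Local Notation op := (ncp_hilbert P -> ncp_hilbert P).
Local Notation alg := (@ncp_alg R P).
Context {W : R -> op} (W_fbm : free_brownian_motion W).
Local Notation Filt := (filtration W).

Lemma filtration_alg t : 0 <= t -> Filt t `<=` alg.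
Proof.
move=> t0 A; apply; split; first exact: ncp_vn.
by move=> _ [s /= + <-]; rewrite in_itv/= => /andP[s0 _]; exact: (fbm_sa W_fbm s0).1.
Qed.

Lemma filtration_star t : 0 <= t -> star_subalgebra (Filt t).
Proof.
move=> t0; have sP : star_subalgebra alg := (ncp_vn P).1.
have F_alg := filtration_alg t0.
split.
- by move=> A /F_alg; exact: (star_bounded sP).
- by move=> M [[sM _] _]; exact: (star_one sM).
- by move=> a A B hA hB M hM; apply: (star_lin hM.1.1); [exact: hA|exact: hB].
- by move=> A B hA hB M hM; apply: (star_mul hM.1.1); [exact: hA|exact: hB].
- move=> A hA; exists (adj A); last by apply: (adjP sP); exact: F_alg.
  by move=> M hM; apply: (adj_star hM.1.1); exact: hA.
Qed.

Lemma filtration_sub s t : s <= t -> Filt s `<=` Filt t.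
Proof.
move=> st A hA M [vM hM]; apply: hA; split => // _ [r /= + <-].
rewrite in_itv/= => /andP[r0 rs]; apply: hM; exists r => //=.
by rewrite in_itv/= r0 (le_trans rs).
Qed.

Lemma filtrationW t : 0 <= t -> Filt t (W t).
Proof. by move=> t0 M [_]; apply; exists t => //=; rewrite in_itv/= t0 lexx. Qed.

Context {b c : R -> op} (b_filt : forall t, 0 <= t -> Filt t (b t))
  (c_filt : forall t, 0 <= t -> Filt t (c t)).

Definition increment x y : op := b x \o (W y - W x) \o c x.

Lemma stoch_sumE p : stoch_sum W b c p = path_sum increment 0 p.
Proof. by rewrite path_sumE. Qed.

Lemma increment_filt x y : 0 <= x -> x <= y -> Filt y (increment x y).
Proof.
move=> x0 xy; have y0 := le_trans x0 xy; have sF := filtration_star y0.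
apply: (star_mul sF); last by apply: (filtration_sub xy); exact: c_filt.
apply: (star_mul sF); first by apply: (filtration_sub xy); exact: b_filt.
apply: (starB sF); first exact: filtrationW.
by apply: (filtration_sub xy); exact: filtrationW.
Qed.

Lemma path_sum_alg x p : 0 <= x -> path <%R x p -> alg (path_sum increment x p).
Proof.
elim: p x => [|y p IH] x x0 /=; first by move=> _; exact: alg0.
move=> /andP[xy py]; have y0 : 0 <= y := le_trans x0 (ltW xy).
apply: algD; last exact: IH.
by apply: (filtration_alg y0); apply: increment_filt => //; exact: ltW.
Qed.

Let increment_sa x y : 0 <= x -> x < y -> ncp_sa (W y - W x).
Proof.
move=> x0 xy; have y0 := le_trans x0 (ltW xy).
have [ax sx] := fbm_sa W_fbm x0; have [ay sy] := fbm_sa W_fbm y0.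
split; first exact: algB.
have := is_adjoint_lin (-1) sx sy.
by rewrite rmorphN1 !scaleN1r addrC.
Qed.

Lemma ip_increment V x y : 0 <= x -> x < y -> Filt x V -> ip V (increment x y) = 0.
Proof.
move=> x0 xy hV; have v0 : 0 < y - x by rewrite subr_gt0.
apply: (ip_free_increment (filtration_star x0) (filtration_alg x0) v0).
- exact: increment_sa.
- exact: (fbm_free W_fbm).
- exact: (fbm_semicircular W_fbm).
- exact: hV.
- exact: b_filt.
- exact: c_filt.
Qed.

Lemma norm2_increment x y : 0 <= x -> x < y ->
  norm2 (increment x y) ^+ 2 = norm2 (b x) ^+ 2 * norm2 (c x) ^+ 2 * (y - x).
Proof.
move=> x0 xy; have v0 : 0 < y - x by rewrite subr_gt0.
apply: (norm2_free_increment (filtration_star x0) (filtration_alg x0) v0).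
- exact: increment_sa.
- exact: (fbm_free W_fbm).
- exact: (fbm_semicircular W_fbm).
- exact: b_filt.
- exact: c_filt.
Qed.

Lemma ip_path_sum V z x p : 0 <= z -> z <= x -> Filt z V -> path <%R x p ->
  ip V (path_sum increment x p) = 0.
Proof.
move=> z0 + hV; have aV := filtration_alg z0 hV.
elim: p x => [|y p IH] x zx /=; first by rewrite ip0r.
move=> /andP[xy py]; have x0 := le_trans z0 zx; have y0 := le_trans x0 (ltW xy).
rewrite ipDr//; last 2 first.
- by apply: (filtration_alg y0); apply: increment_filt => //; exact: ltW.
- exact: path_sum_alg.
rewrite ip_increment// ?add0r; last exact: (filtration_sub zx).
by apply: IH => //; exact: le_trans zx (ltW xy).
Qed.

(** The increments are orthogonal, so that their squared norms add up. *)
Lemma norm2_path_sum x p : 0 <= x -> path <%R x p ->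
  norm2 (path_sum increment x p) ^+ 2 =
  path_sum (fun x y => norm2 (b x) ^+ 2 * norm2 (c x) ^+ 2 * (y - x)) x p.
Proof.
elim: p x => [|y p IH] x x0 /=; first by rewrite norm20 expr0n.
move=> /andP[xy py]; have y0 := le_trans x0 (ltW xy).
have fi : Filt y (increment x y) by apply: increment_filt => //; exact: ltW.
have ai := filtration_alg y0 fi.
have ap := path_sum_alg y0 py.
rewrite norm2_sqr; last exact: algD.
rewrite ipDl ?ipDr ?(ipC ap ai)//; try solve_alg.
rewrite (@ip_path_sum _ y)// addr0 add0r -!norm2_sqr// IH//.
by rewrite norm2_increment.
Qed.

End BrownianSum.
(** * Partitions with controlled left Riemann sums *)

Section GoodPartition.
Context {R : realType}.
Implicit Types (a : nat -> R) (p : seq R) (d e x y : R).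

Definition mesh_from d x p :=
  forall i, (i < size p)%N -> (x :: p)`_i.+1 - (x :: p)`_i < d.

Lemma path_mkseq a n : (forall i, (i < n)%N -> a i < a i.+1) ->
  path <%R (a 0%N) (mkseq (a \o S) n).
Proof.
move=> h; apply/(pathP 0) => i; rewrite size_mkseq => hi.
by rewrite nth_mkseq//=; case: i hi => [|i] hi /=; rewrite ?nth_mkseq ?h// ltnW.
Qed.

Lemma nth_cons_mkseq a n i : (i <= n)%N -> (a 0%N :: mkseq (a \o S) n)`_i = a i.
Proof. by case: i => [|i] hi //=; rewrite nth_mkseq. Qed.

Lemma last_mkseq a n : last (a 0%N) (mkseq (a \o S) n) = a n.
Proof.
by case: n => [|n]//; rewrite (last_nth 0) size_mkseq nth_cons_mkseq.
Qed.

Lemma mesh_mkseq d a n : (forall i, (i < n)%N -> a i.+1 - a i < d) ->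
  mesh_from d (a 0%N) (mkseq (a \o S) n).
Proof.
move=> h i; rewrite size_mkseq => hi.
by rewrite !nth_cons_mkseq ?h// ltnW.
Qed.

Lemma path_sum_mkseq (V : nmodType) (F : R -> R -> V) a n :
  path_sum F (a 0%N) (mkseq (a \o S) n) = \sum_(i < n) F (a i) (a i.+1).
Proof.
rewrite path_sumE size_mkseq; apply: eq_bigr => i _.
by rewrite !nth_cons_mkseq// ltnW.
Qed.

Context {h : R -> R} {Phi : R -> R -> R} {x y : R}.
Hypothesis xy : x < y.
Hypothesis h_ge0 : forall r, x <= r <= y -> 0 <= h r.
Hypothesis Phi_add : forall u v w, x <= u -> u <= v -> v <= w -> w <= y ->
  Phi u w = Phi u v + Phi v w.
Hypothesis Phi_pick : forall e u v, 0 < e -> x <= u -> u < v -> v <= y ->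
  exists2 r, u < r < v & h r * (v - u) <= Phi u v + e.

Let Phi_telescope u l n : x <= u -> 0 <= l -> u + n%:R * l <= y ->
  Phi u (u + n%:R * l) = \sum_(i < n) Phi (u + i%:R * l) (u + i.+1%:R * l).
Proof.
move=> xu l0; elim: n => [|n IH] hn.
  rewrite big_ord0 mul0r addr0; move: hn; rewrite mul0r addr0 => hn.
  by have := Phi_add xu (lexx _) (lexx _) hn; lra.
have le1 : u + n%:R * l <= u + n.+1%:R * l.
  by rewrite lerD2l ler_wpM2r// ler_nat.
have le2 : u <= u + n%:R * l by rewrite lerDl mulr_ge0.
rewrite big_ord_recr /= -IH; last exact: le_trans le1 hn.
by rewrite -Phi_add.
Qed.

(** Each of [n] cells is cut into [m] subcells, and the tag of a cell is chosen
    in its [l]-th subcell, below the average of [h] there.  Consecutive tags are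
    then at distance at most [(m + 1) / m] cells, and for the best [l] the chosen
    subcells carry at most an [m]-th of the whole integral. *)
Lemma good_partition d e : 0 < d -> 0 < e ->
  exists p, [/\ path <%R x p, last x p = y, mesh_from d x p &
    path_sum (fun u v => h u * (v - u)) x p <= Phi x y + e].
Proof.
move=> d0 e0; pose L := y - x; have L0 : 0 < L by rewrite subr_gt0.
(* the error has three parts of size e / 3: the factor 1 + 1 / m, the first
   interval, whose tag x is imposed, and the slack in the choice of the tags *)
have [m [m0 hm]] : exists m, (0 < m)%N /\ Phi x y <= m%:R * (e / 3).
  exists (Num.truncn (`|Phi x y| / (e / 3))).+1; split => //.
  rewrite -ler_pdivrMr; last by lra.
  apply: le_trans (ltW (truncnS_gt _)).
  by rewrite ler_pM2r ?ler_norm// invr_gt0; lra.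
have [n [n0 hnd hne]] : exists n, [/\ (0 < n)%N, 2 * L < n%:R * d & h x * L <= n%:R * (e / 3)].
  pose c := 2 * L / d + h x * L / (e / 3).
  have hx0 : 0 <= h x by apply: h_ge0; rewrite lexx ltW.
  have c1 : 0 <= 2 * L / d by rewrite divr_ge0 ?mulr_ge0// ltW.
  have c2 : 0 <= h x * L / (e / 3) by rewrite divr_ge0 ?mulr_ge0//; lra.
  have hc : c < (Num.truncn c).+1%:R by exact: truncnS_gt.
  exists (Num.truncn c).+1; split => //.
  - by rewrite -ltr_pdivrMr//; apply: le_lt_trans hc; rewrite /c lerDl.
  - by rewrite -ler_pdivrMr; [apply: le_trans (ltW hc); rewrite /c lerDr|lra].
have mR : 0 < m%:R :> R by rewrite ltr0n.
have nR : 0 < n%:R :> R by rewrite ltr0n.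
pose w := L / n%:R; have w0 : 0 < w by rewrite divr_gt0.
pose s := w / m%:R; have s0 : 0 < s by rewrite divr_gt0.
have nw : x + n%:R * w = y by rewrite /w mulrC divfK ?gt_eqF// /L; lra.
have ms : m%:R * s = w by rewrite /s mulrC divfK ?gt_eqF.
pose g j l := x + j%:R * w + l%:R * s.
have gm j : g j m = g j.+1 0%N by rewrite /g ms -natr1; ring.
have g_ge j l : x <= g j l by rewrite /g -addrA lerDl addr_ge0// mulr_ge0// ltW.
have g_le j l : (j < n)%N -> (l <= m)%N -> g j l <= y.
  move=> hj hl; apply: le_trans (_ : g j m <= _).
    by rewrite /g lerD2l ler_wpM2r ?ler_nat// ltW.
  by rewrite gm /g mul0r addr0 -nw lerD2l ler_wpM2r ?ler_nat// ltW.
have g_lt j l : g j l < g j l.+1.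
  by rewrite /g ltrD2l ltr_pM2r// ltr_nat.
have gS j l : g j l.+1 - g j l = s by rewrite /g -natr1; ring.
have tot : Phi x y = \sum_(l < m) \sum_(j < n) Phi (g j l) (g j l.+1).
  rewrite exchange_big /= -nw Phi_telescope// ?nw//; last exact: ltW.
  apply: eq_bigr => j _.
  have := @Phi_telescope (g j 0%N) s m (g_ge _ _) (ltW s0).
  have -> : g j 0%N + m%:R * s = g j.+1 0%N by rewrite -gm /g; ring.
  have -> : g j.+1 0%N = x + j.+1%:R * w by rewrite /g; ring.
  have -> : g j 0%N = x + j%:R * w by rewrite /g; ring.
  apply; rewrite -nw lerD2l ler_wpM2r ?ler_nat//; exact: ltW.
have [l hl] : exists l : 'I_m,
    m%:R * (\sum_(j < n) Phi (g j l) (g j l.+1)) <= Phi x y.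
  apply: contrapT => /forallNP hN.
  have : \sum_(l < m) Phi x y / m%:R < Phi x y.
    rewrite {2}tot; apply: ltr_sum => [|l _].
      by apply/hasP; exists (Ordinal m0) => //; rewrite mem_index_enum.
    by rewrite ltr_pdivrMr// mulrC ltNge; apply/negP; exact: hN.
  by rewrite sumr_const card_ord -[X in X < _]mulr_natr divfK ?gt_eqF// ltxx.
pose e' := e / 3 / (m.+1%:R * n%:R).
have m1R : 0 < m.+1%:R :> R by rewrite ltr0n.
have e'0 : 0 < e' by rewrite divr_gt0 ?mulr_gt0//; lra.
have tagP j : exists r, (j < n)%N ->
    g j l < r < g j l.+1 /\ h r * s <= Phi (g j l) (g j l.+1) + e'.
  have [hj|] := ltnP j n; last by exists 0.
  have [r r1 r2] := Phi_pick e'0 (g_ge j l) (g_lt j l) (g_le _ _ hj (ltn_ord l)).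
  by exists r => _; split=> //; rewrite -(gS j l).
have {tagP} [t ht] := choice tagP.
(* the path: x, the tags, y *)
pose a i := if i is j.+1 then (if (j < n)%N then t j else y) else x.
have a0 : a 0%N = x by [].
have an : a n.+1 = y by rewrite /a ltnn.
have tE j : (j < n)%N -> a j.+1 = t j by move=> hj; rewrite /a hj.
have lm1 : l.+1%:R * s <= w by rewrite -ms ler_wpM2r ?ler_nat// ltW.
have ls : l.+1%:R * s = l%:R * s + s by rewrite -natr1; ring.
have ls0 : 0 <= l%:R * s by rewrite mulr_ge0// ltW.
have jw j : j.+1%:R * w = j%:R * w + w by rewrite -natr1; ring.
have t1 j : (j < n)%N -> x + j%:R * w + l%:R * s < t j < x + j%:R * w + (l%:R * s + s).
  by move=> hj; have [+ _] := ht j hj; rewrite /g ls.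
have gap i : (i <= n)%N -> 0 < a i.+1 - a i <= w + s.
  case: i => [|i] hi.
    by rewrite tE//; have := t1 0%N n0; rewrite mul0r addr0 /= => /andP[]; lra.
  have := t1 i hi; rewrite (tE i hi) => /andP[].
  have [hi'|hi'] := ltnP i.+1 n.
    by rewrite (tE _ hi'); have := t1 _ hi'; rewrite jw => /andP[]; lra.
  have -> : a i.+2 = y by rewrite /a ltnNge hi'.
  have -> : y = x + i%:R * w + w.
    by rewrite -nw -addrA -jw; congr (_ + _%:R * _); apply/eqP; rewrite eqn_leq hi' hi.
  by lra.
have sw : s <= w by rewrite /s ler_pdivrMr// ler_peMr ?ler1n// ltW.
exists (mkseq (a \o S) n.+1); split.
- by rewrite -a0; apply: path_mkseq => i hi; have /andP[+ _] := gap i hi; rewrite subr_gt0.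
- by rewrite -a0 last_mkseq.
- rewrite -a0; apply: mesh_mkseq => i hi; have /andP[_ hg] := gap i hi.
  apply: le_lt_trans hg _.
  have : 2 * w < d by rewrite /w mulrA ltr_pdivrMr// [d * _]mulrC.
  by lra.
- rewrite -{1}a0 path_sum_mkseq big_ord_recl /= -/(a 1%N).
  have hw : h x * (a 1%N - x) <= e / 3.
    have : h x * w <= e / 3 by rewrite /w mulrA ler_pdivrMr// [e / 3 * _]mulrC.
    apply: le_trans; rewrite ler_wpM2l//; first by apply: h_ge0; rewrite lexx ltW.
    by rewrite tE//; have := t1 0%N n0; rewrite mul0r addr0 => /andP[]; lra.
  have key : \sum_(j < n) h (a j.+1) * (a j.+2 - a j.+1) <=
     m.+1%:R * \sum_(j < n) (Phi (g j l) (g j l.+1) + e').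
    rewrite mulr_sumr; apply: ler_sum => j _; rewrite (tE j)//.
    have [hj1 hj2] := ht j (ltn_ord j).
    have ht0 : 0 <= h (t j).
      apply: h_ge0; have /andP[q1 q2] := hj1.
      rewrite (le_trans (g_ge j l) (ltW q1)) (le_trans (ltW q2))//.
      exact: g_le.
    apply: le_trans (_ : h (t j) * (w + s) <= _).
      by rewrite ler_wpM2l// -(tE j)//; have /andP[] := gap j.+1 (ltn_ord j).
    have -> : w + s = m.+1%:R * s by rewrite -ms -natr1; ring.
    by rewrite mulrCA ler_wpM2l// ltW.
  rewrite (le_trans (lerD hw key))// big_split /= sumr_const card_ord mulrDr.
  have -> : m.+1%:R * (e' *+ n) = e / 3.
    by rewrite /e' -[X in _ * X]mulr_natr; field; rewrite !gt_eqF.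
  move: hl; set S := \sum_(j < n) _ => hl.
  have : S <= e / 3 by rewrite -(ler_pM2l mR) (le_trans hl).
  by rewrite -[m.+1%:R]natr1 mulrDl mul1r; lra.
Qed.

End GoodPartition.

(** * Integrals over half-open intervals *)

Section IntervalIntegral.
Context {R : realType}.
Local Notation leb := (@completed_lebesgue_measure R).
Local Notation cara := (caratheodory_type (R := R) (wlength idfun)^*%mu).
Implicit Types (f g : R -> R) (x y z : R).

Lemma cara_measurable_itv (i : interval R) : measurable ([set` i] : set cara).
Proof. by apply: sub_caratheodory; exact: measurable_itv. Qed.

Lemma leb_itv (i : interval R) :
  leb [set` i] = (if (i.1 < i.2)%E then ((i.2 : \bar R) - i.1)%E else 0%E).
Proof. exact: lebesgue_measure_itv. Qed.

Lemma leb_oc x y : x <= y -> leb `]x, y] = (y - x)%:E.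
Proof.
rewrite leb_itv /= lte_fin le_eqVlt => /predU1P[->|->//].
by rewrite ltxx subrr.
Qed.

Definition integrable_oc f x y := leb.-integrable (`]x, y]%classic : set cara) (EFin \o f).

Definition int_oc f x y : R := \int[leb]_(r in (`]x, y]%classic : set cara)) f r.

Lemma integrable_ocS f x y x' y' : x <= x' -> y' <= y ->
  integrable_oc f x y -> integrable_oc f x' y'.
Proof.
move=> xx' yy'; apply: integrableS; [exact: cara_measurable_itv..|].
by apply: subset_itv; rewrite bnd_simp.
Qed.

Lemma integrable_cst_fin (D : set cara) (r : R) : measurable D ->
  (leb D < +oo)%E -> leb.-integrable D (EFin \o cst r).
Proof.
move=> mD Doo; apply/integrableP; split.
  by have -> : EFin \o cst r = cst r%:E by []; exact: measurable_cst.
rewrite (eq_integral (cst `|r|%:E))//.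
by rewrite integral_cst// lte_mul_pinfty.
Qed.

Lemma integrable_oc_cst (r : R) x y : x <= y -> integrable_oc (fun=> r) x y.
Proof.
move=> xy; apply: integrable_cst_fin; first exact: cara_measurable_itv.
by rewrite leb_oc// ltry.
Qed.

Lemma integrable_ocD f g x y : integrable_oc f x y -> integrable_oc g x y ->
  integrable_oc (fun r => f r + g r) x y.
Proof. by move=> hf hg; have := integrableD (cara_measurable_itv _) hf hg. Qed.

Lemma integrable_ocZ (c : R) f x y : integrable_oc f x y ->
  integrable_oc (fun r => c * f r) x y.
Proof. by move=> hf; have := integrableZl (cara_measurable_itv _) c hf. Qed.

Lemma int_oc_add f x y z : x <= y -> y <= z -> integrable_oc f x z ->
  int_oc f x z = int_oc f x y + int_oc f y z.
Proof.
move=> xy yz fi; have e : `]x, z]%classic = (`]x, y] `|` `]y, z])%classic :> set cara.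
  rewrite -itv_bndbnd_setU// ?bnd_simp//.
rewrite /int_oc e Rintegral_setU//; [exact: cara_measurable_itv..|by rewrite -e|].
apply/disj_setPS => r [/=]; rewrite !in_itv/=; lra.
Qed.

Lemma int_oc_le f g x y : integrable_oc f x y -> integrable_oc g x y ->
  (forall r, x < r <= y -> f r <= g r) -> int_oc f x y <= int_oc g x y.
Proof.
move=> fi gi fg; apply: le_Rintegral => //; exact: cara_measurable_itv.
Qed.

Lemma int_oc_ge0 f x y : (forall r, x < r <= y -> 0 <= f r) -> 0 <= int_oc f x y.
Proof. by move=> f0; apply: Rintegral_ge0 => r /=; rewrite in_itv/=; exact: f0. Qed.

Lemma int_ocD f g x y : integrable_oc f x y -> integrable_oc g x y ->
  int_oc (fun r => f r + g r) x y = int_oc f x y + int_oc g x y.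
Proof. by move=> fi gi; apply: RintegralD => //; exact: cara_measurable_itv. Qed.

Lemma int_ocZ (c : R) f x y : integrable_oc f x y ->
  int_oc (fun r => c * f r) x y = c * int_oc f x y.
Proof. by move=> fi; apply: RintegralZl => //; exact: cara_measurable_itv. Qed.

Lemma int_oc_cst (r : R) x y : x <= y -> int_oc (fun=> r) x y = r * (y - x).
Proof.
move=> xy; rewrite /int_oc Rintegral_cst; last exact: cara_measurable_itv.
by have := leb_oc xy => /= ->.
Qed.

(** If [f] exceeded its average on the open interval, its integral over
    [`]x, y - dl]] would already be too large for a small [dl].  The point is found
    strictly inside, so that the tags of a partition are distinct. *)
Lemma int_oc_pick f e x y : 0 < e -> x < y -> integrable_oc f x y ->
  (forall r, x < r <= y -> 0 <= f r) ->
  exists2 r, x < r < y & f r * (y - x) <= int_oc f x y + e.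
Proof.
move=> e0 xy fi f0; apply: contrapT => hN.
pose c := (int_oc f x y + e) / (y - x).
have yx : 0 < y - x by rewrite subr_gt0.
have fc r : x < r < y -> c <= f r.
  move=> xry; rewrite leNgt; apply/negP => h; apply: hN; exists r => //.
  by rewrite -ler_pdivlMr// ltW.
have I0 : 0 <= int_oc f x y by exact: int_oc_ge0.
have c0 : 0 < c by rewrite divr_gt0//; lra.
have cE : c * (y - x) = int_oc f x y + e by rewrite /c divfK ?gt_eqF.
pose dl := Num.min ((y - x) / 2) (e / (2 * c)).
have dl0 : 0 < dl by rewrite lt_min; apply/andP; split; apply: divr_gt0 => //; exact: mulr_gt0.
have dl1 : dl <= (y - x) / 2 by rewrite ge_min lexx.
have dl2 : c * dl <= e / 2.
  apply: le_trans (_ : c * (e / (2 * c)) <= _).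
    by rewrite ler_wpM2l ?(ltW c0)// ge_min lexx orbT.
  rewrite le_eqVlt; apply/orP; left; apply/eqP; field; rewrite gt_eqF//.
have xw : x <= y - dl by lra.
have wy : y - dl <= y by lra.
have := int_oc_add xw wy fi.
have h2 : 0 <= int_oc f (y - dl) y by apply: int_oc_ge0 => r hr; apply: f0; lra.
have h1 : c * (y - dl - x) <= int_oc f x (y - dl).
  rewrite -int_oc_cst//; apply: int_oc_le.
  - exact: integrable_oc_cst.
  - exact: integrable_ocS fi.
  - by move=> r hr; apply: fc; lra.
have : c * (y - dl - x) = c * (y - x) - c * dl by ring.
by lra.
Qed.

(** Absolute continuity of the integral. *)
Lemma int_oc_small f T e : 0 <= T -> integrable_oc f 0 T -> 0 < e ->
  exists2 d, 0 < d & forall x y, 0 <= x -> x <= y -> y <= T -> y - x < d ->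
    int_oc f x y < e.
Proof.
move=> T0 fi e0.
have m : measurable (`]0, T]%classic : set cara) by exact: cara_measurable_itv.
have fi' : leb.-integrable setT (EFin \o (f \_ (`]0, T]%classic : set cara))).
  have := fi; rewrite /integrable_oc integrable_mkcond//.
  by rewrite -restrict_EFin.
have [d [d0 hd]] := integral_normr_continuous fi' e0.
exists d => // x y x0 xy yT yxd.
have lt_d : (leb (`]x, y]%classic : set cara) < d%:E)%E by rewrite leb_oc// lte_fin.
have := hd _ (cara_measurable_itv _) lt_d; apply: le_lt_trans.
apply: le_trans (ler_norm _) _.
have fxy := integrable_ocS x0 yT fi.
apply: le_trans (le_normr_Rintegral _ fxy) _; first exact: cara_measurable_itv.
rewrite le_eqVlt; apply/orP; left; apply/eqP; apply: eq_Rintegral => r.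
rewrite inE /= in_itv/= => /andP[xr ry]; rewrite patchT// inE /= in_itv/=.
by rewrite (le_lt_trans x0 xr) (le_trans ry yT).
Qed.

End IntervalIntegral.
(** * The Bochner integral in the L2 norm *)

Section Bochner.
Context {R : realType} {P : ncProbSpace R}.
Local Notation leb := (@completed_lebesgue_measure R).
Local Notation cara := (caratheodory_type (R := R) (wlength idfun)^*%mu).
Local Notation op := (ncp_hilbert P -> ncp_hilbert P).
Local Notation alg := (@ncp_alg R P).

Lemma integral_indic_scale (D E : set cara) (c : R) : measurable D ->
  measurable E -> (leb (D `&` E) < +oo)%E ->
  leb.-integrable D (EFin \o (fun r => \1_E r * c)) /\
  \int[leb]_(r in D) (\1_E r * c) = fine (leb (D `&` E)) * c.
Proof.
move=> mD mE Eoo.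
have mDE : measurable (D `&` E) by exact: measurableI.
have e : (fun r : cara => \1_E r * c) = (cst c) \_ E.
  by rewrite patch_indic; apply/funext => r /=; rewrite mulrC.
rewrite e; split; last first.
  rewrite -Rintegral_mkcondr Rintegral_cst// mulrC//.
have := integrable_cst_fin c mDE Eoo.
move=> /(integrable_restrict leb mE mD (EFin \o cst c)).
by rewrite restrict_EFin.
Qed.

Lemma integral_simple (I : finType) (D : set cara) (E : I -> set cara) (c : I -> R) :
  measurable D -> (forall i, measurable (E i)) ->
  (forall i, (leb (D `&` E i) < +oo)%E) ->
  leb.-integrable D (EFin \o (fun r => \sum_i \1_(E i) r * c i)) /\
  \int[leb]_(r in D) (\sum_i \1_(E i) r * c i) = \sum_i fine (leb (D `&` E i)) * c i.
Proof.
move=> mD mE Eoo; elim: (index_enum I) => [|i s [IH1 IH2]].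
  have -> : (fun r : cara => \sum_(i <- [::]) \1_(E i) r * c i) = cst 0.
    by apply/funext => r; rewrite big_nil.
  split; first exact: integrable0.
  by rewrite big_nil Rintegral_cst// mul0r.
have -> : (fun r : cara => \sum_(j <- i :: s) \1_(E j) r * c j) =
   (fun r => \1_(E i) r * c i + \sum_(j <- s) \1_(E j) r * c j).
  by apply/funext => r; rewrite big_cons.
have [h1 h2] := integral_indic_scale (c i) mD (mE i) (Eoo i).
split; first by have := integrableD mD h1 IH1.
by rewrite RintegralD// big_cons h2 IH2.
Qed.

(** The integral [V] of a simple function is tested against itself, which reduces
    the triangle inequality to scalar functions. *)
Lemma norm2_simple_integral (I : finType) (D : set cara) (E : I -> set cara)
    (v : I -> op) (h : R -> R) :
  measurable D -> (forall i, measurable (E i)) -> (forall i, E i `<=` D) ->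
  (forall i, (leb (E i) < +oo)%E) -> (forall i, alg (v i)) ->
  measurable_fun D h ->
  (forall r, D r -> norm2 (\sum_i (\1_(E i) r : R)%:C%C *: v i) <= h r) ->
  ((norm2 (\sum_i (fine (leb (E i)))%:C%C *: v i))%:E <= \int[leb]_(r in D) (h r)%:E)%E.
Proof.
move=> mD mE ED Eoo va mh hle.
have h0 r : D r -> 0 <= h r by move=> Dr; apply: le_trans (hle r Dr); exact: norm2_ge0.
have I0 : (0 <= \int[leb]_(r in D) (h r)%:E)%E.
  by apply: integral_ge0 => r Dr; rewrite lee_fin h0.
have [->|Ioo] := eqVneq (\int[leb]_(r in D) (h r)%:E)%E +oo%E; first exact: leey.
have hi : leb.-integrable D (EFin \o h).
  apply/integrableP; split; first exact/measurable_EFinP.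
  have -> : (\int[leb]_(r in D) `|(EFin \o h) r| = \int[leb]_(r in D) (h r)%:E)%E.
    by apply: eq_integral => r; rewrite inE => Dr /=; rewrite ger0_norm// h0.
  by rewrite ltey.
have IE : (\int[leb]_(r in D) (h r)%:E)%E = (\int[leb]_(r in D) h r)%:E.
  by rewrite /Rintegral fineK// ge0_fin_numE// ltey.
rewrite IE lee_fin.
set V := \sum_i _; have aV : alg V by rewrite /V; solve_alg.
have DE i : D `&` E i = E i by apply/setIidr/ED.
have DEoo i : (leb (D `&` E i) < +oo)%E by rewrite DE.
have [gi gE] := integral_simple (fun i => ip V (v i)) mD mE DEoo.
have nV : norm2 V ^+ 2 <= norm2 V * \int[leb]_(r in D) h r.
  have -> : norm2 V ^+ 2 = \int[leb]_(r in D) (\sum_i \1_(E i) r * ip V (v i)).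
    rewrite gE norm2_sqr// {2}/V ip_sumr//; last by move=> i; solve_alg.
    by apply: eq_bigr => i _; rewrite ipZr ?DE.
  rewrite -RintegralZl//; apply: le_Rintegral => //.
    by have := integrableZl mD (norm2 V) hi.
  move=> r Dr; have -> : \sum_i \1_(E i) r * ip V (v i) =
      ip V (\sum_i (\1_(E i) r : R)%:C%C *: v i).
    rewrite ip_sumr//; last by move=> i; solve_alg.
    by apply: eq_bigr => i _; rewrite ipZr.
  apply: le_trans (ler_norm _) _; apply: le_trans (ip_norm2 aV _) _; first by solve_alg.
  by rewrite ler_wpM2l ?norm2_ge0 ?hle.
have := norm2_ge0 V; rewrite le_eqVlt => /predU1P[<-|V0].
  by rewrite -lee_fin -IE.
by rewrite -(ler_pM2l V0) -expr2.
Qed.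

Local Notation Icc y := (`[0%R, y%R]%classic : set cara).
Local Notation Ioc x y := (`]x%R, y%R]%classic : set cara).

(** The integral of [s] over [`]a, b]]. *)
Definition simple_int (D : set R) (s : @simple_function R P D) (a b : R) : op :=
  \sum_(j < sf_size s) (fine (leb (sf_set s j `&` `]a, b]%classic)))%:C%C *: sf_val s j.

Lemma sf_eval_alg (D : set R) (s : @simple_function R P D) r : alg (sf_eval s r).
Proof. by apply: alg_sum => j; apply: algZ; exact: sf_alg. Qed.

Lemma sf_integral_alg (D : set R) (s : @simple_function R P D) : alg (sf_integral s).
Proof. by apply: alg_sum => j; apply: algZ; exact: sf_alg. Qed.

Lemma simple_int_alg (D : set R) (s : @simple_function R P D) a b :
  alg (simple_int s a b).
Proof. by apply: alg_sum => j; apply: algZ; exact: sf_alg. Qed.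

Lemma leb_sub_itv (E : set cara) (i : interval R) : measurable E ->
  E `<=` [set` i] -> (leb [set` i] < +oo)%E -> (leb E < +oo)%E.
Proof.
move=> mE Ei; apply: le_lt_trans; apply: le_measure => //; rewrite inE//.
exact: cara_measurable_itv.
Qed.

Lemma leb_cc (x y : R) : (leb `[x, y] < +oo)%E.
Proof. by rewrite leb_itv /=; case: ifP => _; rewrite ?ltry// -EFinB ltry. Qed.

Lemma measurable_restrict_sub (D E : set cara) (g : cara -> R) : measurable D ->
  measurable E -> E `<=` D -> measurable_fun E g -> measurable_fun D (g \_ E).
Proof.
move=> mD mE ED mg.
apply/measurable_restrict => //.
by rewrite ?(setIidl ED) ?(setIidr ED).
Qed.

Lemma integral_restrict_sub (D E : set cara) (g : cara -> R) : E `<=` D ->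
  (\int[leb]_(r in E) (g r)%:E = \int[leb]_(r in D) ((g \_ E) r)%:E)%E.
Proof.
move=> ED; rewrite -{1}(setIidr ED) integral_mkcondr.
by apply: eq_integral => r _; rewrite restrict_EFin.
Qed.

Lemma integral_add3 (D : set cara) (g1 g2 g3 : cara -> R) : measurable D ->
  (forall r, 0 <= g1 r) -> (forall r, 0 <= g2 r) -> (forall r, 0 <= g3 r) ->
  measurable_fun D g1 -> measurable_fun D g2 -> measurable_fun D g3 ->
  (\int[leb]_(r in D) (g1 r)%:E + \int[leb]_(r in D) (g2 r)%:E +
   \int[leb]_(r in D) (g3 r)%:E = \int[leb]_(r in D) (g1 r + g2 r + g3 r)%:E)%E.
Proof.
move=> mD g10 g20 g30 m1 m2 m3.
have add (f1 f2 : cara -> R) : (forall r, 0 <= f1 r) -> (forall r, 0 <= f2 r) ->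
    measurable_fun D f1 -> measurable_fun D f2 ->
    (\int[leb]_(r in D) (f1 r + f2 r)%:E =
     \int[leb]_(r in D) (f1 r)%:E + \int[leb]_(r in D) (f2 r)%:E)%E.
  move=> f10 f20 mf1 mf2.
  have := @ge0_integralD _ _ _ leb D mD (EFin \o f1) (EFin \o f2).
  by apply; [move=> r _; rewrite lee_fin|exact/measurable_EFinP|
    move=> r _; rewrite lee_fin|exact/measurable_EFinP].
have g120 r : 0 <= g1 r + g2 r by rewrite addr_ge0.
have m12 := measurable_funD m1 m2.
by rewrite (add (fun r => g1 r + g2 r) g3 g120 g30 m12 m3) (add g1 g2 g10 g20 m1 m2).
Qed.

(** The integrals up to [x] and up to [y] come with approximants on different
    intervals.  On [`[0, x]] both approximate [f]; on [`]x, y]] the approximant [sy]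
    is compared with the given [s].  The three are assembled into one simple function
    on [`[0, y]] that is small in norm. *)
Section Increment.
Context {T x y : R} {f : R -> op}.
Context {sx : @simple_function R P `[0, x]} {sy : @simple_function R P `[0, y]}
  {s : @simple_function R P `[0, T]}.
Hypotheses (x0 : 0 <= x) (xy : x <= y) (yT : y <= T).
Hypothesis fa : forall r, 0 <= r <= T -> alg (f r).

Let I := ('I_(sf_size sy) + ('I_(sf_size sx) + 'I_(sf_size s)))%type.

Let E (i : I) : set cara := match i with
  | inl i => sf_set sy i | inr (inl i) => sf_set sx i
  | inr (inr i) => sf_set s i `&` (Ioc x y) end.

Let v (i : I) : op := match i with
  | inl i => sf_val sy i | inr (inl i) => - sf_val sx i
  | inr (inr i) => - sf_val s i end.

Let rx : cara -> R := (fun r => opnorm (f r - sf_eval sx r)) \_ (Icc x).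
Let rs : cara -> R := (fun r => opnorm (f r - sf_eval s r)) \_ (Ioc x y).
Let ry : cara -> R := fun r => opnorm (f r - sf_eval sy r).

Let rx0 r : 0 <= rx r.
Proof. by rewrite /rx patchE; case: ifP => // _; exact: opnorm_ge0. Qed.

Let rs0 r : 0 <= rs r.
Proof. by rewrite /rs patchE; case: ifP => // _; exact: opnorm_ge0. Qed.

Let ry0 r : 0 <= ry r. Proof. exact: opnorm_ge0. Qed.

Let sumI (F : I -> op) : \sum_i F i = \sum_j F (inl j) + \sum_j F (inr (inl j)) +
  \sum_j F (inr (inr j)).
Proof. by rewrite big_sumType big_sumType /= addrA. Qed.

Let intE : sf_integral sy - sf_integral sx - simple_int s x y =
  \sum_i (fine (leb (E i)))%:C%C *: v i.
Proof.
rewrite sumI; congr (_ + _ + _).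
- by rewrite /sf_integral -sumrN; apply: eq_bigr => j _; rewrite scalerN.
- by rewrite /simple_int -sumrN; apply: eq_bigr => j _; rewrite scalerN.
Qed.

Let evalE r : 0 <= r <= y -> \sum_i (\1_(E i) r : R)%:C%C *: v i =
  sf_eval sy r - (if r <= x then sf_eval sx r else sf_eval s r).
Proof.
move=> /andP[r0 ry_]; rewrite sumI /=.
have [rx_|xr] := leP r x.
  have -> : \sum_(j < sf_size s) (\1_(sf_set s j `&` (Ioc x y)) r : R)%:C%C *: - sf_val s j = 0.
    rewrite big1// => j _; rewrite indicE memNset ?scale0r//.
    by move=> [_ /=]; rewrite in_itv/= ltNge rx_.
  have -> : \sum_(j < sf_size sx) (\1_(sf_set sx j) r : R)%:C%C *: - sf_val sx j = - sf_eval sx r.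
    by rewrite /sf_eval -sumrN; apply: eq_bigr => j _; rewrite scalerN.
  by rewrite addr0.
have -> : \sum_(j < sf_size sx) (\1_(sf_set sx j) r : R)%:C%C *: - sf_val sx j = 0.
  rewrite big1// => j _; rewrite indicE memNset ?scale0r//.
  by move=> /sf_sub /=; rewrite in_itv/= => /andP[_]; rewrite leNgt xr.
rewrite addr0; congr (_ + _).
rewrite /sf_eval -sumrN; apply: eq_bigr => j _; rewrite scalerN !indicE.
have -> // : (r \in sf_set s j `&` (Ioc x y)) = (r \in sf_set s j).
rewrite in_setI; have -> : r \in Ioc x y by rewrite inE /= in_itv/= xr ry_.
by rewrite andbT.
Qed.

Let eval_le r : 0 <= r <= y ->
  norm2 (\sum_i (\1_(E i) r : R)%:C%C *: v i) <= ry r + rx r + rs r.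
Proof.
move=> r0y; rewrite evalE//; have /andP[r0 ry_] := r0y.
have fr : alg (f r) by apply: fa; rewrite r0 (le_trans ry_ yT).
have ay := sf_eval_alg sy r; have ax := sf_eval_alg sx r; have as_ := sf_eval_alg s r.
have key (B : op) : alg B -> sf_eval sy r - B = (f r - B) - (f r - sf_eval sy r).
  by move=> _; rewrite opprB [RHS]addrCA [in RHS]addrAC subrr add0r.
have [rx_|xr] := leP r x.
  rewrite key//; apply: le_trans (norm2B _ _) _; [solve_alg..|].
  rewrite -addrA addrCA lerD//.
    apply: le_trans (_ : rx r <= _) => //.
    by rewrite /rx patchT ?norm2_le_opnorm//; [solve_alg|rewrite inE/= in_itv/= r0].
  apply: le_trans (_ : ry r <= _); last by rewrite lerDl.
  by apply: norm2_le_opnorm; solve_alg.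
rewrite key//; apply: le_trans (norm2B _ _) _; [solve_alg..|].
rewrite addrC lerD//.
  apply: le_trans (_ : ry r <= _); last by rewrite lerDl.
  by apply: norm2_le_opnorm; solve_alg.
by rewrite /rs patchT ?norm2_le_opnorm//; [solve_alg|rewrite inE/= in_itv/= xr].
Qed.

Lemma norm2_simple_increment :
  measurable_fun (Icc x) (fun r : cara => opnorm (f r - sf_eval sx r)) ->
  measurable_fun (Icc y) (fun r : cara => opnorm (f r - sf_eval sy r)) ->
  measurable_fun (Icc T) (fun r : cara => opnorm (f r - sf_eval s r)) ->
  ((norm2 (sf_integral sy - sf_integral sx - simple_int s x y))%:E <=
   \int[leb]_(r in Icc y) (opnorm (f r - sf_eval sy r))%:E +
   \int[leb]_(r in Icc x) (opnorm (f r - sf_eval sx r))%:E +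
   \int[leb]_(r in Ioc x y) (opnorm (f r - sf_eval s r))%:E)%E.
Proof.
move=> mx my ms.
have mitv (i : interval R) : measurable ([set` i] : set cara) by exact: cara_measurable_itv.
have sub0 : Icc x `<=` Icc y by apply: subset_itv; rewrite bnd_simp.
have sub1 : Ioc x y `<=` Icc y by apply: subset_itv; rewrite bnd_simp.
have sub2 : Ioc x y `<=` Icc T by apply: subset_itv; rewrite bnd_simp.
have mrx : measurable_fun (Icc y) rx := measurable_restrict_sub (mitv _) (mitv _) sub0 mx.
have mrs : measurable_fun (Icc y) rs :=
  measurable_restrict_sub (mitv _) (mitv _) sub1 (measurable_funS (mitv _) sub2 ms).
have -> : (\int[leb]_(r in Icc y) (opnorm (f r - sf_eval sy r))%:E +
   \int[leb]_(r in Icc x) (opnorm (f r - sf_eval sx r))%:E +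
   \int[leb]_(r in Ioc x y) (opnorm (f r - sf_eval s r))%:E)%E =
   (\int[leb]_(r in Icc y) (ry r + rx r + rs r)%:E)%E.
  rewrite (integral_restrict_sub (fun r : cara => opnorm (f r - sf_eval sx r)) sub0).
  rewrite (integral_restrict_sub (fun r : cara => opnorm (f r - sf_eval s r)) sub1).
  exact: (integral_add3 (mitv _) ry0 rx0 rs0 my mrx mrs).
rewrite intE; apply: (norm2_simple_integral (h := fun r => ry r + rx r + rs r) (mitv `[0, y])).
- case=> [j|[j|j]]; rewrite /E; [exact: sf_measurable..|].
  by apply: measurableI; [exact: sf_measurable|exact: mitv].
- case=> [j|[j|j]]; rewrite /E; first exact: sf_sub.
  + by apply: subset_trans sub0; exact: sf_sub.
  + by apply: subset_trans sub1 => r [].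
- case=> [j|[j|j]]; rewrite /E.
  + by apply: leb_sub_itv (leb_cc 0 y); [exact: sf_measurable|exact: sf_sub].
  + by apply: leb_sub_itv (leb_cc 0 x); [exact: sf_measurable|exact: sf_sub].
  + apply: leb_sub_itv (leb_cc 0 y); last by apply: subset_trans sub1 => r [].
    by apply: measurableI; [exact: sf_measurable|exact: mitv].
- by case=> [j|[j|j]]; rewrite /v; [|apply: algN..]; exact: sf_alg.
- exact: (measurable_funD (measurable_funD my mrx) mrs).
- by move=> r; rewrite /= in_itv/=; exact: eval_le.
Qed.

End Increment.

End Bochner.
Section BochnerIncrement.
Context {R : realType} {P : ncProbSpace R}.
Local Notation leb := (@completed_lebesgue_measure R).
Local Notation cara := (caratheodory_type (R := R) (wlength idfun)^*%mu).
Local Notation op := (ncp_hilbert P -> ncp_hilbert P).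
Local Notation alg := (@ncp_alg R P).
Local Notation Icc y := (`[0%R, y%R]%classic : set cara).
Local Notation Ioc x y := (`]x%R, y%R]%classic : set cara).

Lemma ereal_cvg0_lt (u : nat -> \bar R) (e : R) : 0 < e ->
  u n @[n --> \oo] --> 0%E -> \forall n \near \oo, (u n < e%:E)%E.
Proof.
move=> e0 /fine_cvgP[hf /cvgr0_norm_lt /(_ _ e0) hl].
near=> n; have fn : u n \is a fin_num by near: n.
rewrite -(fineK fn) lte_fin; apply: le_lt_trans (ler_norm _) _.
by near: n.
Unshelve. all: end_near. Qed.

Lemma bochner_near (x e : R) (f : R -> op) (A : op) : 0 < e ->
  is_bochner_integral x f A ->
  exists s : @simple_function R P `[0, x],
    [/\ measurable_fun (Icc x) (fun r : cara => opnorm (f r - sf_eval s r)),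
      (\int[leb]_(r in Icc x) (opnorm (f r - sf_eval s r))%:E < e%:E)%E &
      norm2 (A - sf_integral s) < e].
Proof.
move=> e0 [aA [s [ms hI hA]]].
have h1 := ereal_cvg0_lt e0 hI.
move: (hA) => /cvgr0_norm_lt /(_ _ e0) h2.
have [n [n1 n2]] : exists n, (\int[leb]_(r in Icc x) (opnorm (f r - sf_eval (s n) r))%:E < e%:E)%E /\
   `|opnorm (sf_integral (s n) - A)| < e.
  case: h1 => N1 _ q1; case: h2 => N2 _ q2; exists (maxn N1 N2).
  by split; [apply: q1|apply: q2]; rewrite /= leq_max leqnn ?orbT.
exists (s n); split => //.
have as_ := sf_integral_alg (s n).
rewrite -opprB norm2N; last by solve_alg.
apply: le_lt_trans (norm2_le_opnorm _) _; first by solve_alg.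
exact: le_lt_trans (ler_norm _) n2.
Qed.

Lemma integral_oc (g : cara -> R) (x y : R) : integrable_oc g x y ->
  (\int[leb]_(r in Ioc x y) (g r)%:E)%E = (int_oc g x y)%:E.
Proof.
move=> gi; rewrite /int_oc /Rintegral fineK//.
by apply: integrable_fin_num => //; exact: cara_measurable_itv.
Qed.

(** Passing to the limit removes the approximants of both integrals.  The simple
    function [s] is arbitrary: close to [f], it locates the increment up to a small
    error; equal to zero, it bounds the increment. *)
Lemma bochner_increment (T x y : R) (f : R -> op) (A B : op)
    (s : @simple_function R P `[0, T]) :
  0 <= x -> x <= y -> y <= T -> (forall r, 0 <= r <= T -> alg (f r)) ->
  is_bochner_integral x f A -> is_bochner_integral y f B ->
  measurable_fun (Icc T) (fun r : cara => opnorm (f r - sf_eval s r)) ->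
  integrable_oc (fun r => opnorm (f r - sf_eval s r)) x y ->
  norm2 (B - A - simple_int s x y) <= int_oc (fun r => opnorm (f r - sf_eval s r)) x y.
Proof.
move=> x0 xy yT fa hA hB ms hi; have aA := hA.1; have aB := hB.1.
rewrite -lee_fin; apply/lee_addgt0Pr => e e0.
have e4 : 0 < e / 4 by rewrite divr_gt0.
have [sx [mx Ix nx]] := bochner_near e4 hA.
have [sy [my Iy ny]] := bochner_near e4 hB.
have := norm2_simple_increment x0 xy yT fa mx my ms.
rewrite (integral_oc hi) => h.
have : ((norm2 (sf_integral sy - sf_integral sx - simple_int s x y))%:E <=
   (e / 4)%:E + (e / 4)%:E + (int_oc (fun r => opnorm (f r - sf_eval s r)) x y)%:E)%E.
  by apply: le_trans h _; apply: leeD => //; apply: leeD; exact: ltW.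
rewrite -!EFinD !lee_fin => {}h.
have ax := sf_integral_alg sx; have ay := sf_integral_alg sy.
have a_s := simple_int_alg s x y.
have -> : B - A - simple_int s x y = (sf_integral sy - sf_integral sx - simple_int s x y) +
   ((B - sf_integral sy) - (A - sf_integral sx)).
  rewrite opprB [RHS](AC (3*(2*2)) ((4*7*3)*((1*5)*(2*6)))).
  by rewrite /= subrr addNr !addr0.
apply: le_trans (norm2D _ _) _; [solve_alg..|].
have := @norm2B _ _ (B - sf_integral sy) (A - sf_integral sx).
have [q1 q2] : alg (B - sf_integral sy) /\ alg (A - sf_integral sx) by split; solve_alg.
move=> /(_ q1 q2); lra.
Qed.

Lemma bochner_simple_approx (T e : R) (f : R -> op) (A : op) : 0 < e ->
  0 <= T -> is_bochner_integral T f A ->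
  exists s : @simple_function R P `[0, T],
    [/\ measurable_fun (Icc T) (fun r : cara => opnorm (f r - sf_eval s r)),
      integrable_oc (fun r => opnorm (f r - sf_eval s r)) 0 T &
      int_oc (fun r => opnorm (f r - sf_eval s r)) 0 T < e].
Proof.
move=> e0 T0 /(bochner_near e0)[s [ms hI _]].
have ocs : Ioc 0 T `<=` Icc T by apply: subset_itv; rewrite bnd_simp.
have ms' : measurable_fun (Ioc 0 T) (fun r : cara => opnorm (f r - sf_eval s r)).
  exact: measurable_funS (cara_measurable_itv _) ocs ms.
have hI' : (\int[leb]_(r in Ioc 0 T) (opnorm (f r - sf_eval s r))%:E < e%:E)%E.
  apply: le_lt_trans hI; apply: ge0_subset_integral.
  - exact: cara_measurable_itv.
  - exact: cara_measurable_itv.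
  - exact/measurable_EFinP.
  - by move=> r _; rewrite lee_fin opnorm_ge0.
  - exact: ocs.
have hi : integrable_oc (fun r => opnorm (f r - sf_eval s r)) 0 T.
  apply/integrableP; split; first exact/measurable_EFinP.
  apply: le_lt_trans (lt_trans hI' (ltry _)).
  rewrite le_eqVlt; apply/orP; left; apply/eqP; apply: eq_integral => r _ /=.
  by rewrite ger0_norm// opnorm_ge0.
by exists s; split => //; rewrite -lte_fin -integral_oc.
Qed.

Definition simple0 (D : set R) : @simple_function R P D :=
  @SimpleFunction R P D 0 (fun=> set0) (fun=> 0) (fun=> measurable0)
    (fun=> @sub0set _ D) (fun=> alg0).

Lemma sf_eval0 D r : sf_eval (simple0 D) r = 0.
Proof. by rewrite /sf_eval big_ord0. Qed.

Lemma simple_int0 D a b : simple_int (simple0 D) a b = 0.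
Proof. by rewrite /simple_int big_ord0. Qed.

Lemma mem_L1_oc (T : R) (g : R -> R) : mem_Lp 1%E T g ->
  measurable_fun (Icc T) (g : cara -> R) /\ integrable_oc g 0 T.
Proof.
move=> /Lfun1_integrable hg.
have mT : measurable (Icc T) by exact: cara_measurable_itv.
have hi : leb.-integrable (Icc T) (EFin \o g).
  by apply/(integrable_mkcond _ mT); move: hg; rewrite restrict_EFin.
split.
  by apply/measurable_EFinP; case/integrableP: hi.
apply: integrableS hi => //; first exact: cara_measurable_itv.
by apply: subset_itv; rewrite bnd_simp.
Qed.

Lemma mem_L2_oc (T : R) (g : R -> R) : mem_Lp 2%:E T g ->
  integrable_oc (fun r => g r ^+ 2) 0 T.
Proof.
move=> /Lfun2_integrable_sqr hg.
have mT : measurable (Icc T) by exact: cara_measurable_itv.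
have hi : leb.-integrable (Icc T) (EFin \o (fun r => g r ^+ 2)).
  apply/(integrable_mkcond _ mT); move: hg.
  rewrite restrict_EFin; congr (_.-integrable _ (_ \o _)); apply/funext => r.
  by rewrite !patchE; case: ifP => // _; rewrite expr0n.
apply: integrableS hi => //; first exact: cara_measurable_itv.
by apply: subset_itv; rewrite bnd_simp.
Qed.

Lemma bochner_increment_norm (T x y : R) (f : R -> op) (A B : op) :
  0 <= x -> x <= y -> y <= T -> (forall r, 0 <= r <= T -> alg (f r)) ->
  mem_Lp 1%E T (fun r => opnorm (f r)) ->
  is_bochner_integral x f A -> is_bochner_integral y f B ->
  norm2 (B - A) <= int_oc (fun r => opnorm (f r)) x y.
Proof.
move=> x0 xy yT fa /mem_L1_oc[mf fi] hA hB.
have e : (fun r => opnorm (f r - sf_eval (simple0 `[0, T]%classic) r)) = (fun r => opnorm (f r)).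
  by apply/funext => r; rewrite sf_eval0 subr0.
have := @bochner_increment T x y f A B (simple0 _) x0 xy yT fa hA hB.
rewrite simple_int0 subr0 e; apply => //.
exact: integrable_ocS fi.
Qed.

End BochnerIncrement.
(** * Increments of the stochastic integral *)

Section PathLemmas.
Context {R : realType}.
Implicit Types (x d : R) (p q : seq R) (F G : R -> R -> R).

Lemma mesh_fromE d x p : mesh_from d x p <-> path (fun u v => v - u < d) x p.
Proof. by split=> [h|/(pathP 0)]; [apply/(pathP 0)|exact]. Qed.

Lemma mesh_from_cat d x p q : mesh_from d x p -> mesh_from d (last x p) q ->
  mesh_from d x (p ++ q).
Proof. by rewrite !mesh_fromE cat_path => -> ->. Qed.

Lemma path_lt_last x p : path <%R x p -> x <= last x p.
Proof.
elim: p x => [|y p IH] x //= /andP[xy py].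
exact: le_trans (ltW xy) (IH _ py).
Qed.

Lemma path_sum_le F G x p : path <%R x p ->
  (forall u v, x <= u -> u < v -> v <= last x p -> F u v <= G u v) ->
  path_sum F x p <= path_sum G x p.
Proof.
elim: p x => [|y p IH] x //= /andP[xy py] h.
apply: lerD; first by apply: h => //; exact: path_lt_last.
by apply: IH => // u v yu; apply: h; exact: le_trans (ltW xy) yu.
Qed.

Lemma path_sum_sum (I : finType) (F : I -> R -> R -> R) x p :
  \sum_i path_sum (F i) x p = path_sum (fun u v => \sum_i F i u v) x p.
Proof.
elim: p x => [|y p IH] x /=; first by rewrite big1.
by rewrite big_split /= IH.
Qed.

Lemma path_sum_scale (a : R) F x p :
  a * path_sum F x p = path_sum (fun u v => a * F u v) x p.
Proof. by elim: p x => [|y p IH] x /=; rewrite ?mulr0// mulrDr IH. Qed.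

(** Any partition that is good for the zero function will do. *)
Lemma exists_partition x d : 0 <= x -> 0 < d ->
  exists2 p, itv_partition 0 x p & mesh_lt p d.
Proof.
move=> + d0; rewrite le_eqVlt => /predU1P[<-|x0]; first by exists [::].
have [|||p [p1 p2 p3 _]] := @good_partition R (fun=> 0) (fun _ _ => 0) 0 x x0 _ _ _ d 1 d0 ltr01.
- by [].
- by move=> *; rewrite addr0.
- move=> e u v e0 _ uv _; exists ((u + v) / 2); first by lra.
  by rewrite mul0r add0r ltW.
- by exists p => //; split => //; apply/eqP.
Qed.

Lemma sqr_sum_le (k : nat) (a : 'I_k -> R) :
  (\sum_i a i) ^+ 2 <= k%:R * \sum_i a i ^+ 2.
Proof.
have : 0 <= \sum_i \sum_j (a i - a j) ^+ 2.
  by apply: sumr_ge0 => i _; apply: sumr_ge0 => j _; exact: sqr_ge0.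
have -> : \sum_i \sum_j (a i - a j) ^+ 2 =
    2 * (k%:R * \sum_i a i ^+ 2 - (\sum_i a i) ^+ 2).
  transitivity (\sum_i (k%:R * a i ^+ 2 - 2 * a i * (\sum_j a j) + \sum_j a j ^+ 2)).
    apply: eq_bigr => i _.
    transitivity (\sum_(j < k) (a i ^+ 2 - 2 * a i * a j + a j ^+ 2)).
      by apply: eq_bigr => j _; ring.
    rewrite !big_split /= sumr_const card_ord mulr_sumr sumrN.
    by rewrite (mulr_natl (a i ^+ 2) k).
  rewrite !big_split /= sumr_const card_ord -mulr_sumr sumrN -mulr_suml -mulr_sumr.
  by rewrite -[X in _ + X]mulr_natl; ring.
by rewrite pmulr_rge0// subr_ge0.
Qed.

Lemma exists_common_bound (k : nat) (d : 'I_k -> R) : (forall i, 0 < d i) ->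
  exists2 m, 0 < m & forall i, m <= d i.
Proof.
move=> d0; exists (\big[Num.min/1]_i d i).
  by apply: lt_bigmin => // i _; exact: d0.
by move=> i; apply: bigmin_le_cond.
Qed.

End PathLemmas.

Section StochIncrement.
Context {R : realType} {P : ncProbSpace R}.
Local Notation op := (ncp_hilbert P -> ncp_hilbert P).
Local Notation alg := (@ncp_alg R P).
Context {W : R -> op} (W_fbm : free_brownian_motion W).
Local Notation Filt := (filtration W).
Context {k : nat} {b c : 'I_k -> R -> op}.
Hypothesis b_filt : forall i t, 0 <= t -> Filt t (b i t).
Hypothesis c_filt : forall i t, 0 <= t -> Filt t (c i t).

(** The factor [k] comes from Cauchy-Schwarz over the [k] stochastic integrals, which
    need not be orthogonal to each other. *)
Definition diffusion_density (r : R) : R :=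
  k%:R * \sum_i norm2 (b i r) ^+ 2 * norm2 (c i r) ^+ 2.

Lemma diffusion_density_ge0 r : 0 <= diffusion_density r.
Proof.
rewrite mulr_ge0// sumr_ge0// => i _; rewrite mulr_ge0// sqr_ge0//.
Qed.

Lemma norm2_sum_sqr (A : 'I_k -> op) : (forall i, alg (A i)) ->
  norm2 (\sum_i A i) ^+ 2 <= k%:R * \sum_i norm2 (A i) ^+ 2.
Proof.
move=> aA; apply: le_trans (sqr_sum_le _).
rewrite ler_pXn2r// ?nnegrE ?norm2_ge0 ?sumr_ge0//; first exact: norm2_sum.
by move=> i _; exact: norm2_ge0.
Qed.

(** A partition of [`[0, x]] is continued by a good partition [q] of [`[x, y]]: the
    Riemann sums of the two integrals then differ by the sum along [q], which has the
    stated properties exactly. *)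
Lemma stoch_integral_approx x y h e (Mx My : 'I_k -> op) :
  0 <= x -> x < y -> 0 < e ->
  (forall i, is_stoch_integral x W (b i) (c i) (Mx i)) ->
  (forall i, is_stoch_integral y W (b i) (c i) (My i)) ->
  (forall r, x <= r <= y -> diffusion_density r <= h r) ->
  integrable_oc h x y ->
  exists S, [/\ alg S, norm2 (\sum_i (My i - Mx i) - S) <= e,
    norm2 S ^+ 2 <= int_oc h x y + e & forall V, Filt x V -> ip V S = 0].
Proof.
move=> x0 xy e0 hMx hMy hG hi.
have y0 : 0 <= y := le_trans x0 (ltW xy).
have aMx i : alg (Mx i) := (hMx i).1; have aMy i : alg (My i) := (hMy i).1.
pose e' := e / (2 * k.+1%:R).
have e'0 : 0 < e' by rewrite divr_gt0// mulr_gt0.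
have /choice[dx hdx] : forall i, exists d, 0 < d /\ forall p, itv_partition 0 x p ->
    mesh_lt p d -> opnorm (stoch_sum W (b i) (c i) p - Mx i) < e'.
  by move=> i; have [d d0 hd] := (hMx i).2 e' e'0; exists d.
have /choice[dy hdy] : forall i, exists d, 0 < d /\ forall p, itv_partition 0 y p ->
    mesh_lt p d -> opnorm (stoch_sum W (b i) (c i) p - My i) < e'.
  by move=> i; have [d d0 hd] := (hMy i).2 e' e'0; exists d.
have [mx mx0 hmx] := exists_common_bound (fun i => (hdx i).1).
have [my my0 hmy] := exists_common_bound (fun i => (hdy i).1).
pose d := Num.min mx my; have d0 : 0 < d by rewrite lt_min mx0.
have dxle i : d <= dx i by rewrite ge_min hmx.
have dyle i : d <= dy i by rewrite ge_min hmy orbT.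
have [p [pp pl] pm] := exists_partition x0 d0.
have h0 r : x <= r <= y -> 0 <= h r.
  by move=> hr; apply: le_trans (hG r hr); exact: diffusion_density_ge0.
have [||q [qp ql qm qs]] := @good_partition R h (int_oc h) x y xy h0 _ _ d e d0 e0.
- move=> u v w xu uv vw wy; apply: int_oc_add => //; exact: integrable_ocS hi.
- move=> e1 u v e10 xu uv vy; apply: int_oc_pick => //; first exact: integrable_ocS hi.
  by move=> r /andP[ur rv]; apply: h0; rewrite (le_trans xu (ltW ur)) (le_trans rv vy).
have plx : last 0 p = x by exact/eqP.
have pq : itv_partition 0 y (p ++ q).
  by split; rewrite ?last_cat ?plx ?ql// cat_path pp plx.
have meshW p' d' : d <= d' -> mesh_lt p' d -> mesh_lt p' d'.
  by move=> dd hp' i hi'; apply: lt_le_trans (hp' i hi') dd.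
have pqm : mesh_lt (p ++ q) d by apply: mesh_from_cat; rewrite ?plx.
pose s i := path_sum (increment (W := W) (b := b i) (c := c i)) x q.
have as_ i : alg (s i) by exact: (path_sum_alg W_fbm (b_filt i) (c_filt i) x0 qp).
exists (\sum_i s i); split.
- by solve_alg.
- rewrite -sumrB; apply: le_trans (norm2_sum _ _) _; first by move=> i; solve_alg.
  apply: le_trans (_ : \sum_(i < k) 2 * e' <= _); last first.
    rewrite sumr_const card_ord -[X in X <= _]mulr_natl /e'.
    have -> : k%:R * (2 * (e / (2 * k.+1%:R))) = e * (k%:R / k.+1%:R).
      by field; rewrite nat1r pnatr_eq0.
    by rewrite ger_pMr// ler_pdivrMr// mul1r ler_nat.
  apply: ler_sum => i _.
  have as1 : alg (stoch_sum W (b i) (c i) p).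
    by rewrite stoch_sumE; exact: (path_sum_alg W_fbm (b_filt i) (c_filt i) (lexx 0) pp).
  have as2 : alg (stoch_sum W (b i) (c i) (p ++ q)).
    by rewrite stoch_sumE; exact: (path_sum_alg W_fbm (b_filt i) (c_filt i) (lexx 0) pq.1).
  have -> : My i - Mx i - s i = - (stoch_sum W (b i) (c i) (p ++ q) - My i) +
      (stoch_sum W (b i) (c i) p - Mx i).
    have -> : s i = stoch_sum W (b i) (c i) (p ++ q) - stoch_sum W (b i) (c i) p.
      by rewrite !stoch_sumE path_sum_cat plx addrAC subrr add0r.
    by rewrite !opprB [LHS](AC (2*2) ((1*4)*(3*2))).
  apply: le_trans (norm2D _ _) _; [solve_alg..|].
  rewrite norm2N; last by solve_alg.
  rewrite mulr2n mulrDl mul1r; apply: lerD.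
    apply: le_trans (norm2_le_opnorm _) _; first by solve_alg.
    by apply/ltW; apply: (hdy i).2 => //; exact: meshW pqm.
  apply: le_trans (norm2_le_opnorm _) _; first by solve_alg.
  by apply/ltW; apply: (hdx i).2 => //; exact: meshW pm.
- apply: le_trans (norm2_sum_sqr as_) _; apply: le_trans qs.
  rewrite (eq_bigr (fun i => path_sum (fun u v => norm2 (b i u) ^+ 2 * norm2 (c i u) ^+ 2 * (v - u)) x q)); last first.
    by move=> i _; exact: (norm2_path_sum W_fbm (b_filt i) (c_filt i) x0 qp).
  rewrite path_sum_sum path_sum_scale; apply: path_sum_le => // u v xu uv; rewrite ql => vy.
  rewrite -mulr_suml mulrA ler_wpM2r ?subr_ge0 ?(ltW uv)//.
  by apply: hG; rewrite xu (le_trans (ltW uv) vy).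
- move=> V hV; have aV := filtration_alg W_fbm x0 hV.
  rewrite ip_sumr// big1// => i _.
  exact: (ip_path_sum W_fbm (b_filt i) (c_filt i) x0 (lexx x) hV qp).
Qed.

(** The Riemann sums of [stoch_integral_approx] have both properties up to an error
    that can be made arbitrarily small. *)
Lemma stoch_integral_increment x y h (Mx My : 'I_k -> op) :
  0 <= x -> x < y ->
  (forall i, is_stoch_integral x W (b i) (c i) (Mx i)) ->
  (forall i, is_stoch_integral y W (b i) (c i) (My i)) ->
  (forall r, x <= r <= y -> diffusion_density r <= h r) ->
  integrable_oc h x y ->
  norm2 (\sum_i (My i - Mx i)) ^+ 2 <= int_oc h x y /\
  forall V, Filt x V -> ip V (\sum_i (My i - Mx i)) = 0.
Proof.
move=> x0 xy hMx hMy hG hi.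
have aD : alg (\sum_i (My i - Mx i)).
  apply: alg_sum => i; have aMx := (hMx i).1; have aMy := (hMy i).1; solve_alg.
move: aD (fun e e0 => @stoch_integral_approx x y h e Mx My x0 xy e0 hMx hMy hG hi).
set D := \sum_i _; set I := int_oc h x y => aD approx.
have I0 : 0 <= I.
  apply: int_oc_ge0 => r /andP[xr ry].
  by apply: le_trans (hG r _); [exact: diffusion_density_ge0|rewrite (ltW xr)].
split.
  apply/ler_addgt0Pr => e e0.
  (* (d + n)^2 <= I + (2 I + 6) d as soon as n^2 <= I + d, 2 n <= n^2 + 1 and d <= 1 *)
  pose d := Num.min 1 (e / (2 * I + 6)).
  have d0 : 0 < d by rewrite lt_min ltr01 divr_gt0//; lra.
  have d1 : d <= 1 by rewrite ge_min lexx.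
  have d2 : d * (2 * I + 6) <= e by rewrite -ler_pdivlMr ?ge_min ?lexx ?orbT//; lra.
  have [S [aS DS SI _]] := approx d d0.
  have nD : norm2 D <= d + norm2 S.
    have -> : D = (D - S) + S by rewrite subrK.
    by apply: le_trans (norm2D _ _) _; [solve_alg..|rewrite lerD2r].
  have nS0 := norm2_ge0 S; have nD0 := norm2_ge0 D.
  have : norm2 D ^+ 2 <= (d + norm2 S) ^+ 2 by rewrite ler_pXn2r// nnegrE; lra.
  have : 2 * norm2 S <= norm2 S ^+ 2 + 1 by have := sqr_ge0 (norm2 S - 1); lra.
  nra.
move=> V hV; have aV := filtration_alg W_fbm x0 hV; apply/eqP.
rewrite -normr_eq0 eq_le normr_ge0 andbT; apply/ler_addgt0Pr => e e0; rewrite add0r.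
have nV := norm2_ge0 V.
pose d := e / (norm2 V + 1); have d0 : 0 < d by rewrite divr_gt0//; lra.
have [S [aS DS _ VS]] := approx d d0.
have -> : ip V D = ip V (D - S) by rewrite ipBr// VS// subr0.
apply: le_trans (ip_norm2 aV _) _; first by solve_alg.
apply: le_trans (_ : norm2 V * d <= _); first by rewrite ler_wpM2l.
by rewrite /d mulrA ler_pdivrMr; nra.
Qed.

End StochIncrement.
(** * Decay of the L2 norm of a solution *)

(** A discrete Gronwall argument on a uniform grid of mesh [w < d].  One step
    multiplies [N] by [1 - la * w], which is at most [expR (- la * w)]; being at most
    one, this factor lets the errors [Err] add up without amplification. *)
Lemma discrete_decay (R : realType) (N : R -> R) (Err : R -> R -> R)
    (T d la : R) : 0 < T -> 0 < d -> 0 <= la ->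
  (forall x, 0 <= N x) ->
  (forall x y, 0 <= x -> x <= y -> y <= T -> 0 <= Err x y) ->
  (forall x y z, 0 <= x -> x <= y -> y <= z -> z <= T ->
    Err x z = Err x y + Err y z) ->
  (forall x y, 0 <= x -> x < y -> y <= T -> y - x < d ->
    N y <= N x - la * N x * (y - x) + Err x y) ->
  N T <= expR (- la * T) * N 0 + Err 0 T.
Proof.
move=> T0 d0 la0 N0 Th0 Thadd step.
pose n := (Num.truncn (T / d + la * T)).+1.
have nT : T / d + la * T < n%:R by exact: truncnS_gt.
have laT : 0 <= la * T by rewrite mulr_ge0// ltW.
have Td : 0 <= T / d by rewrite divr_ge0// ltW.
have nR : 0 < n%:R :> R by rewrite ltr0n.
pose w := T / n%:R; have w0 : 0 < w by rewrite divr_gt0.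
have nw : n%:R * w = T by rewrite /w mulrC divfK ?gt_eqF.
have wd : w < d.
  by rewrite /w ltr_pdivrMr// mulrC -ltr_pdivrMr//; lra.
have law : la * w <= 1.
  by rewrite /w mulrA ler_pdivrMr// mul1r; lra.
have key i : (i <= n)%N ->
    N (i%:R * w) <= expR (- la * (i%:R * w)) * N 0 + Err 0 (i%:R * w).
  elim: i => [_|i IH hi].
    rewrite mul0r mulr0 expR0 mul1r.
    by have := Th0 0 0 (lexx _) (lexx _) (ltW T0); lra.
  have iw0 : 0 <= i%:R * w by rewrite mulr_ge0// ltW.
  have iS : i.+1%:R * w = i%:R * w + w by rewrite -natr1 mulrDl mul1r.
  have hiT : i%:R * w + w <= T.
    by rewrite -iS -nw ler_wpM2r ?ler_nat// ltW.
  have {}IH := IH (ltnW hi).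
  have le1 : i%:R * w <= i%:R * w + w by lra.
  have := step (i%:R * w) (i%:R * w + w) iw0 _ hiT _.
  have -> : i%:R * w + w - i%:R * w = w by lra.
  have lt1 : i%:R * w < i%:R * w + w by lra.
  move=> /(_ lt1 wd) st.
  rewrite iS (Thadd 0 (i%:R * w))//.
  have hTh : 0 <= Err 0 (i%:R * w) by apply: Th0 => //; lra.
  have e1 : 1 - la * w <= expR (- la * w).
    by have := expR_ge1Dx (- la * w); lra.
  have -> : - la * (i%:R * w + w) = - la * (i%:R * w) + - la * w by ring.
  rewrite expRD.
  have c0 := expR_ge0 (- la * (i%:R * w)); have N20 := N0 0.
  set c := expR (- la * (i%:R * w)) in IH c0 *; set e := expR _ in e1 *.
  set a := Err 0 _ in IH hTh *; set N1 := N (i%:R * w) in IH st *.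
  set N2 := N 0 in IH N20 *.
  have s1 : (1 - la * w) * N1 <= (1 - la * w) * (c * N2 + a) by rewrite ler_wpM2l//; lra.
  have s2 : (1 - la * w) * (c * N2) <= e * (c * N2) by rewrite ler_wpM2r// mulr_ge0.
  have s3 : 0 <= la * w * a by rewrite !mulr_ge0// ltW.
  lra.
by have := key n (leqnn n); rewrite nw.
Qed.

Section SimpleTest.
Context {R : realType} {P : ncProbSpace R}.
Local Notation leb := (@completed_lebesgue_measure R).
Local Notation cara := (caratheodory_type (R := R) (wlength idfun)^*%mu).
Local Notation op := (ncp_hilbert P -> ncp_hilbert P).
Local Notation alg := (@ncp_alg R P).
Context {D : set R} (s : @simple_function R P D).

Lemma ip_simple_integral V x y : alg V -> x <= y ->
  integrable_oc (fun r => ip V (sf_eval s r)) x y /\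
  int_oc (fun r => ip V (sf_eval s r)) x y = ip V (simple_int s x y).
Proof.
move=> aV xy.
have mI : measurable (`]x, y]%classic : set cara) by exact: cara_measurable_itv.
have Eoo (j : 'I_(sf_size s)) : (leb ((`]x, y]%classic : set cara) `&` sf_set s j) < +oo)%E.
  apply: (@leb_sub_itv R _ `]x, y]).
  - by apply: measurableI => //; exact: sf_measurable.
  - by move=> r [].
  - by rewrite leb_oc// ltry.
have [h1 h2] := integral_simple (fun j => ip V (sf_val s j)) mI (@sf_measurable _ _ _ s) Eoo.
have e : (fun r => ip V (sf_eval s r)) =
    (fun r : cara => \sum_j \1_(sf_set s j) r * ip V (sf_val s j)).
  apply/funext => r; rewrite /sf_eval ip_sumr//; last first.
    by move=> j; apply: algZ; exact: sf_alg.
  by apply: eq_bigr => j _; rewrite ipZr//; exact: sf_alg.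
rewrite e; split=> //; rewrite /int_oc h2 /simple_int ip_sumr//; last first.
  by move=> j; apply: algZ; exact: sf_alg.
apply: eq_bigr => j _; rewrite ipZr; [|exact: aV|exact: sf_alg].
by rewrite setIC.
Qed.

Definition simple_bound : R := \sum_(j < sf_size s) norm2 (sf_val s j).

Lemma norm2_sf_eval r : norm2 (sf_eval s r) <= simple_bound.
Proof.
apply: le_trans (norm2_sum _ _) _; first by move=> j; apply: algZ; exact: sf_alg.
apply: ler_sum => j _; rewrite norm2Z; last exact: sf_alg.
rewrite ler_piMl ?norm2_ge0// indicE; case: (_ \in _); rewrite ?normr1 ?normr0//.
Qed.

Lemma simple_bound_ge0 : 0 <= simple_bound.
Proof. by apply: sumr_ge0 => j _; exact: norm2_ge0. Qed.

End SimpleTest.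

Section Perturbation.
Context {R : realType} {P : ncProbSpace R}.
Local Notation op := (ncp_hilbert P -> ncp_hilbert P).
Local Notation alg := (@ncp_alg R P).
Implicit Types (u v A B : op) (K w I r b : R).

Lemma ler_sqr_D1 (x y : R) : x ^+ 2 <= y -> x <= y + 1.
Proof. by have := sqr_ge0 (x - 1); nra. Qed.

Lemma norm2_sqr_shift u A B : alg u -> alg A -> alg B -> ip u B = 0 ->
  norm2 (u + A + B) ^+ 2 = norm2 u ^+ 2 + 2 * ip u A + norm2 (A + B) ^+ 2.
Proof.
move=> au aA aB uB; have aAB : alg (A + B) by exact: algD.
have auAB : alg (u + (A + B)) by exact: algD.
rewrite -addrA !norm2_sqr// (ipDl auAB au aAB) (ipDr au au aAB).
by rewrite (ipDr aAB au aAB) (ipC aAB au) (ipDr au aA aB) uB; ring.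
Qed.

Lemma norm2_sqrD_le A B w I : alg A -> alg B -> norm2 A <= w -> norm2 B <= w ->
  norm2 A <= I -> norm2 (A + B) ^+ 2 <= norm2 B ^+ 2 + 3 * w * I.
Proof.
move=> aA aB Aw Bw AI; have t1 := norm2D aA aB.
have t2 := norm2_ge0 A; have t3 := norm2_ge0 B; have t4 := norm2_ge0 (A + B).
have : norm2 (A + B) ^+ 2 <= (norm2 A + norm2 B) ^+ 2.
  by rewrite ler_pXn2r// nnegrE addr_ge0.
have : norm2 A * (norm2 A + 2 * norm2 B) <= I * (3 * w).
  by apply: ler_pM => //; lra.
by lra.
Qed.

Lemma norm2_sqr_close u v K w : alg u -> alg v -> norm2 u <= K -> norm2 v <= K ->
  norm2 (v - u) <= 2 * w -> norm2 u ^+ 2 <= norm2 v ^+ 2 + 4 * w * K.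
Proof.
move=> au av uK vK vuw.
have : norm2 u <= norm2 v + 2 * w.
  have -> : u = v - (v - u) by rewrite opprB addrC subrK.
  apply: le_trans (norm2B _ _) _; [solve_alg..|].
  by rewrite lerD2l.
have w0 : 0 <= 2 * w by apply: le_trans vuw; exact: norm2_ge0.
have := norm2_ge0 u; have := norm2_ge0 v.
move: (norm2 u) (norm2 v) uK vK => x y; clear -w0; nra.
Qed.

Lemma ip_close u v A B K w r b : alg u -> alg v -> alg A -> alg B ->
  norm2 v <= K -> norm2 (v - u) <= 2 * w -> norm2 (A - B) <= r -> norm2 B <= b ->
  ip u B <= ip v A + K * r + 2 * w * b.
Proof.
move=> au av aA aB vK vuw ABr Bb.
have e1 : ip v A = ip v (A - B) + ip (v - u) B + ip u B.
  by rewrite ipBr// ipBl//; ring.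
have aAB : alg (A - B) by solve_alg.
have avu : alg (v - u) by solve_alg.
have /ler_normlP[t1 _] := ip_norm2 av aAB.
have /ler_normlP[t2 _] := ip_norm2 avu aB.
have t3 : norm2 v * norm2 (A - B) <= K * r by rewrite ler_pM ?norm2_ge0.
have t4 : norm2 (v - u) * norm2 B <= 2 * w * b by rewrite ler_pM ?norm2_ge0.
by rewrite e1; lra.
Qed.

Lemma ip_le_close u A B K r : alg u -> alg A -> alg B -> norm2 u <= K ->
  norm2 (A - B) <= r -> ip u A <= K * r + ip u B.
Proof.
move=> au aA aB uK ABr.
have aAB : alg (A - B) by solve_alg.
have := ler_normlW (ip_norm2 au aAB); rewrite ipBr//.
have : norm2 u * norm2 (A - B) <= K * r by rewrite ler_pM ?norm2_ge0.
by lra.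
Qed.

End Perturbation.

Section Solution.
Context {R : realType} {P : ncProbSpace R}.
Local Notation cara := (caratheodory_type (R := R) (wlength idfun)^*%mu).
Local Notation op := (ncp_hilbert P -> ncp_hilbert P).
Local Notation alg := (@ncp_alg R P).
Local Notation psi := (@ncp_trace R P).
Context {W : R -> op} (W_fbm : free_brownian_motion W)
  {k : nat} {alpha : op -> op} {beta gamma : 'I_k -> op -> op}
  (alpha_sa : forall A, ncp_sa A -> ncp_sa (alpha A))
  (beta_filt : forall i, preserves_filtration W (beta i))
  (gamma_filt : forall i, preserves_filtration W (gamma i))
  {L : R} (L_gt0 : 0 < L)
  (dissipative : forall A, ncp_sa A ->
    complex.Re (psi (A \o alpha A)) +
      k%:R / 2 * \sum_(i < k) norm2 (beta i A) ^+ 2 * norm2 (gamma i A) ^+ 2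
    <= - L * norm2 A ^+ 2)
  {U : R -> op} (U_sol : free_sde_solution W alpha beta gamma U)
  {T : R} (T_gt0 : 0 < T).

Let a r := alpha (U r).
Let b i r := beta i (U r).
Let c i r := gamma i (U r).
Let G := diffusion_density (b := b) (c := c).
Let N r := norm2 (U r) ^+ 2.

Let U_alg r : 0 <= r -> alg (U r).
Proof. by move=> r0; exact: (sol_sa U_sol r0).1. Qed.

Let a_alg r : 0 <= r -> alg (a r).
Proof. by move=> r0; exact: (alpha_sa (sol_sa U_sol r0)).1. Qed.

Let b_filt i r : 0 <= r -> filtration W r (b i r).
Proof.
by move=> r0; apply: beta_filt => //; [exact: (sol_sa U_sol)|exact: (sol_adapted U_sol)].
Qed.

Let c_filt i r : 0 <= r -> filtration W r (c i r).
Proof.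
by move=> r0; apply: gamma_filt => //; [exact: (sol_sa U_sol)|exact: (sol_adapted U_sol)].
Qed.

Let density_le r : 0 <= r -> G r <= - 2 * L * N r - 2 * ip (U r) (a r).
Proof.
move=> r0; have := dissipative (sol_sa U_sol r0).
rewrite /ip (adj_eq (sol_sa U_sol r0).2) -/(a r) /G /diffusion_density -/(N r).
rewrite -/(b _ r); set x := complex.Re _; set y := \sum_(i < k) _.
by rewrite [k%:R / 2 * y]mulrAC; lra.
Qed.

(** Integrable majorants of the norm of the drift and of the diffusion density, for
    a priori bounds. *)
Let g1 (r : R) := opnorm (a r).
Let g2 (r : R) := k%:R * \sum_i (opnorm (b i r) * opnorm (c i r)) ^+ 2.

Let g1_int : integrable_oc g1 0 T.
Proof. by have [] := mem_L1_oc (sol_drift U_sol T_gt0). Qed.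

Let g2_int : integrable_oc g2 0 T.
Proof.
apply: integrable_ocZ.
elim: (index_enum 'I_k) => [|i s IH].
  have -> : (fun r : R => \sum_(i <- [::]) (opnorm (b i r) * opnorm (c i r)) ^+ 2) = (fun=> 0).
    by apply/funext => r; rewrite big_nil.
  by apply: integrable_oc_cst; exact: ltW.
have -> : (fun r : R => \sum_(j <- i :: s) (opnorm (b j r) * opnorm (c j r)) ^+ 2) =
   (fun r => (opnorm (b i r) * opnorm (c i r)) ^+ 2 +
      \sum_(j <- s) (opnorm (b j r) * opnorm (c j r)) ^+ 2).
  by apply/funext => r; rewrite big_cons.
by apply: integrable_ocD => //; exact: mem_L2_oc (sol_diffusion U_sol i T_gt0).
Qed.

Let g1_ge0 r : 0 <= g1 r. Proof. exact: opnorm_ge0. Qed.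

Let g2_ge0 r : 0 <= g2 r.
Proof. by rewrite mulr_ge0// sumr_ge0// => i _; exact: sqr_ge0. Qed.

Let density_le_g2 r : 0 <= r -> G r <= g2 r.
Proof.
move=> r0; rewrite ler_wpM2l//; apply: ler_sum => i _; rewrite -exprMn.
have ab := filtration_alg W_fbm r0 (b_filt i r0).
have ac := filtration_alg W_fbm r0 (c_filt i r0).
rewrite ler_pXn2r// ?nnegrE ?mulr_ge0 ?norm2_ge0 ?opnorm_ge0//.
by rewrite ler_pM ?norm2_ge0 ?norm2_le_opnorm.
Qed.

(** Fixes the integrals up to [x] and up to [y], and collects what the energy
    estimate needs to know of the drift part [DA] and the martingale part [DM]. *)
Let increment_split x y : 0 <= x -> x < y -> y <= T -> exists DA DM : op,
  [/\ alg DA, alg DM, U y = U x + DA + DM, norm2 DA <= int_oc g1 x y &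
   [/\ forall s : @simple_function R P `[0, T],
        measurable_fun (`[0, T]%classic : set cara) (fun r : cara => opnorm (a r - sf_eval s r)) ->
        integrable_oc (fun r => opnorm (a r - sf_eval s r)) x y ->
        norm2 (DA - simple_int s x y) <= int_oc (fun r => opnorm (a r - sf_eval s r)) x y,
      forall h, (forall r, x <= r <= y -> G r <= h r) -> integrable_oc h x y ->
        norm2 DM ^+ 2 <= int_oc h x y &
      ip (U x) DM = 0]].
Proof.
move=> x0 xy yT; have y0 := le_trans x0 (ltW xy).
have xT : x \in `[0, T] by rewrite in_itv/= x0 (le_trans (ltW xy)).
have yT' : y \in `[0, T] by rewrite in_itv/= y0.
have [Ax [Mx [hAx hMx eUx]]] := sol_eq U_sol T_gt0 xT.
have [Ay [My [hAy hMy eUy]]] := sol_eq U_sol T_gt0 yT'.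
have aMx i : alg (Mx i) := (hMx i).1; have aMy i : alg (My i) := (hMy i).1.
have aAx := hAx.1; have aAy := hAy.1.
have fa r : 0 <= r <= T -> alg (a r) by move=> /andP[r0 _]; exact: a_alg.
exists (Ay - Ax), (\sum_i (My i - Mx i)); split.
- by solve_alg.
- by apply: alg_sum => i; solve_alg.
- rewrite eUx eUy sumrB; set S1 := \sum_i _; set S2 := \sum_i _.
  rewrite [RHS](AC (3*2*2) ((1*4*6)*((2*5)*(3*7)))) /=.
  by rewrite !subrr !addr0.
- exact: bochner_increment_norm (ltW xy) yT fa (sol_drift U_sol T_gt0) hAx hAy.
- split.
  + by move=> s ms hs; exact: bochner_increment (ltW xy) yT fa hAx hAy ms hs.
  + move=> h hG hi.
    by have [] := stoch_integral_increment W_fbm b_filt c_filt x0 xy hMx hMy hG hi.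
  + have [|_] := @stoch_integral_increment _ _ _ W_fbm _ _ _ b_filt c_filt _ _ g2 _ _ x0 xy hMx hMy _
      (integrable_ocS x0 yT g2_int).
      by move=> r /andP[xr _]; apply: density_le_g2; exact: le_trans xr.
    by apply; exact: (sol_adapted U_sol).
Qed.

Let norm2_U_bound : exists2 K, 0 <= K & forall r, 0 <= r <= T -> norm2 (U r) <= K.
Proof.
have I1 : 0 <= int_oc g1 0 T by exact: int_oc_ge0.
have I2 : 0 <= int_oc g2 0 T by exact: int_oc_ge0.
have nU := norm2_ge0 (U 0).
exists (norm2 (U 0) + int_oc g1 0 T + (int_oc g2 0 T + 1)); first by lra.
move=> r /andP[]; rewrite le_eqVlt => /predU1P[<- _|r0 rT]; first by lra.
have [DA [DM [aA aM -> hA [_ hM _]]]] := increment_split (lexx 0) r0 rT.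
have aU := U_alg (lexx 0).
apply: le_trans (norm2D _ _) _; [solve_alg..|]; apply: lerD.
  apply: le_trans (norm2D _ _) _; [solve_alg..|]; apply: lerD => //.
  apply: le_trans hA _.
  rewrite (int_oc_add (ltW r0) rT g1_int) lerDl; exact: int_oc_ge0.
have := hM g2 _ (integrable_ocS (lexx 0) rT g2_int).
have gh x : 0 <= x <= r -> G x <= g2 x by move=> /andP[x0 _]; exact: density_le_g2.
move=> /(_ gh).
rewrite (int_oc_add (ltW r0) rT g2_int).
have : 0 <= int_oc g2 r T by exact: int_oc_ge0.
move=> I0 /ler_sqr_D1/le_trans; apply.
by rewrite lerD2r lerDl.
Qed.

Let small_increments w : 0 < w -> exists2 d, 0 < d &
  forall x y DA DM, 0 <= x -> x <= y -> y <= T -> y - x < d ->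
    norm2 DA <= int_oc g1 x y -> norm2 DM ^+ 2 <= int_oc g2 x y ->
    norm2 (DA : op) <= w /\ norm2 (DM : op) <= w.
Proof.
move=> w0; have w20 : 0 < w ^+ 2 by rewrite exprn_gt0.
have [d1 d10 h1] := int_oc_small (ltW T_gt0) g1_int w0.
have [d2 d20 h2] := int_oc_small (ltW T_gt0) g2_int w20.
exists (Num.min d1 d2); first by rewrite lt_min d10.
move=> x y DA DM x0 xy yT; rewrite lt_min => /andP[xd1 xd2] hA hM; split.
  by apply: le_trans hA (ltW _); exact: h1.
rewrite -(@ler_pXn2r _ 2)// ?nnegrE ?norm2_ge0// ?ltW//.
by apply: le_lt_trans hM _; exact: h2.
Qed.

(** The diffusion density need not be measurable in time.  A simple function [s] that
    is close to the drift in L1 repairs this: by dissipativity the density on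
    [`[x, y]] is below the measurable function [h], which is
    [- 2 L N x - 2 ip (U x) (s r)] up to small errors.  Integrating [h] bounds the
    martingale part of [N y - N x], and the term with [s] cancels the drift part
    [2 ip (U x) DA]. *)
Let local_decay e : 0 < e -> exists d (Err : R -> R -> R),
  [/\ 0 < d,
    forall x y, 0 <= x -> x <= y -> y <= T -> 0 <= Err x y,
    forall x y z, 0 <= x -> x <= y -> y <= z -> z <= T ->
      Err x z = Err x y + Err y z,
    Err 0 T <= e &
    forall x y, 0 <= x -> x < y -> y <= T -> y - x < d ->
      N y <= N x - 2 * L * N x * (y - x) + Err x y].
Proof.
move=> e0; have T0 := ltW T_gt0.
have [K K0 hK] := norm2_U_bound.
have TT : T \in `[0, T] by rewrite in_itv/= T0 lexx.
have [A0 [_ [hA0 _ _]]] := sol_eq U_sol T_gt0 TT.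
(* the L1 error of [s] enters the estimate with the factor 4 K *)
have e1 : 0 < e / (8 * K + 1) by rewrite divr_gt0//; lra.
have [s [ms rho_int rho_small]] := bochner_simple_approx e1 T0 hA0.
pose rho (r : R) := opnorm (a r - sf_eval s r).
pose B := simple_bound s; have B0 : 0 <= B := simple_bound_ge0 s.
pose C := int_oc g1 0 T; have C0 : 0 <= C by exact: int_oc_ge0.
pose q := (8 * L * K + 4 * B) * T + 3 * C.
have q0 : 0 <= q.
  by rewrite addr_ge0 ?mulr_ge0// addr_ge0 ?mulr_ge0// ltW.
(* both parts of the increments of [U] stay below [w] over times shorter than d *)
pose w := e / (2 * q + 1); have w0 : 0 < w by rewrite divr_gt0//; lra.
have [d d0 hd] := small_increments w0.
pose Err x y := w * (8 * L * K + 4 * B) * (y - x) + 4 * K * int_oc rho x y +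
   3 * w * int_oc g1 x y.
have rho0 r : 0 <= rho r := opnorm_ge0 _.
have LK0 : 0 <= 8 * L * K + 4 * B by rewrite addr_ge0 ?mulr_ge0// ltW.
exists d, Err; split => //.
- move=> x y x0 xy yT; rewrite /Err.
  have j1 : 0 <= int_oc rho x y by exact: int_oc_ge0.
  have j2 : 0 <= int_oc g1 x y by exact: int_oc_ge0.
  have w1 := ltW w0; have yx : 0 <= y - x by rewrite subr_ge0.
  by apply: addr_ge0; [apply: addr_ge0|]; apply: mulr_ge0 => //; apply: mulr_ge0.
- move=> x y z x0 xy yz zT; rewrite /Err.
  rewrite (int_oc_add xy yz (integrable_ocS x0 zT rho_int)).
  by rewrite (int_oc_add xy yz (integrable_ocS x0 zT g1_int)); ring.
- have -> : Err 0 T = w * q + 4 * K * int_oc rho 0 T by rewrite /Err /q /C; ring.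
  have : w * q <= e / 2.
    by rewrite /w mulrAC ler_pdivrMr; lra.
  have : 4 * K * int_oc rho 0 T <= 4 * K * (e / (8 * K + 1)).
    by rewrite ler_wpM2l ?mulr_ge0// ltW.
  have : 4 * K * (e / (8 * K + 1)) <= e / 2.
    by rewrite mulrA ler_pdivrMr; lra.
  lra.
- move=> x y x0 xy yT yxd; have y0 := le_trans x0 (ltW xy).
  have [DA [DM [aA aM eU hA [hAs hM ipM]]]] := increment_split x0 xy yT.
  have aU := U_alg x0; have xT := le_trans (ltW xy) yT.
  have nUK : norm2 (U x) <= K by rewrite hK// x0.
  have Kw0 : 0 <= K * w by rewrite mulr_ge0// ltW.
  have rho_xy := integrable_ocS x0 yT rho_int.
  have g1_xy := integrable_ocS x0 yT g1_int.
  have g2_xy := integrable_ocS x0 yT g2_int.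
  have G2 u r : 0 <= u -> u <= r -> G r <= g2 r.
    by move=> u0 ur; apply: density_le_g2; exact: le_trans ur.
  have [nA nM] : norm2 DA <= w /\ norm2 DM <= w.
    apply: (hd x y) => //; first exact: ltW.
    by apply: hM => // r /andP[xr _]; exact: G2 xr.
  have near r : x <= r <= y -> norm2 (U r - U x) <= 2 * w.
    move=> /andP[]; rewrite le_eqVlt => /predU1P[<- _|xr ry].
      by rewrite subrr norm20 mulr_ge0// ltW.
    have rT := le_trans ry yT.
    have [EA [EM [bA bM -> kA [_ kM _]]]] := increment_split x0 xr rT.
    have [mA mM] : norm2 EA <= w /\ norm2 EM <= w.
      apply: (hd x r) => //; [exact: ltW|by apply: le_lt_trans yxd; rewrite lerD2r|].
      apply: kM (integrable_ocS x0 rT g2_int) => t /andP[xt _]; exact: G2 xt.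
    rewrite -[U x + EA + EM]addrA addrAC subrr add0r.
    by apply: le_trans (norm2D bA bM) _; rewrite mulr2n mulrDl mul1r lerD.
  have as_ r : alg (sf_eval s r) := sf_eval_alg s r.
  have aS : alg (simple_int s x y) := simple_int_alg s x y.
  pose cst0 := - 2 * L * N x + w * (8 * L * K + 4 * B).
  pose h r := (cst0 + 2 * K * rho r) + - 2 * ip (U x) (sf_eval s r).
  have hG r : x <= r <= y -> G r <= h r.
    move=> xry; have /andP[xr ry] := xry; have r0 := le_trans x0 xr.
    have aUr := U_alg r0; have aar := a_alg r0.
    have nr := near r xry.
    have nrK : norm2 (U r) <= K by rewrite hK// r0 (le_trans ry).
    apply: le_trans (density_le r0) _.
    have q1 : N x <= N r + 4 * w * K := norm2_sqr_close aU aUr nUK nrK nr.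
    have aars : alg (a r - sf_eval s r) by exact: algB.
    have q2 := ip_close aU aUr aar (as_ r) nrK nr (norm2_le_opnorm aars) (norm2_sf_eval s r).
    have q3 : L * N x <= L * (N r + 4 * w * K) by rewrite ler_wpM2l// ltW.
    rewrite /h /cst0 -/(rho r) -/B in q2 *.
    move: q2 q3; move: (N x) (N r) (ip _ _) (ip _ _) (rho r).
    by move=> *; lra.
  have [p_int p_E] := ip_simple_integral s aU (ltW xy).
  have h_int1 : integrable_oc (fun r => cst0 + 2 * K * rho r) x y.
    by apply: integrable_ocD; [exact: integrable_oc_cst (ltW xy)|exact: integrable_ocZ].
  have h_int2 := integrable_ocZ (- 2) p_int.
  have hh := hM h hG (integrable_ocD h_int1 h_int2).
  have hE : int_oc h x y = cst0 * (y - x) + 2 * K * int_oc rho x y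
      - 2 * ip (U x) (simple_int s x y).
    rewrite (int_ocD h_int1 h_int2) int_ocD ?int_oc_cst ?int_ocZ ?p_E//.
    - by rewrite mulNr.
    - exact: ltW.
    - exact: integrable_oc_cst (ltW xy).
    - exact: integrable_ocZ.
  have dAs := hAs s ms rho_xy.
  have ipA := ip_le_close aU aA aS nUK dAs.
  have nAM := norm2_sqrD_le aA aM nA nM hA.
  rewrite {1}/N eU (norm2_sqr_shift aU aA aM ipM) -/(N x) /Err.
  move: ipA nAM hh; rewrite hE /cst0 -/rho; lra.
Qed.

Lemma solution_decay : N T <= expR (- (2 * L) * T) * N 0.
Proof.
apply/ler_addgt0Pr => e e0.
have [d [Err [d0 Th0 Thadd ThT step]]] := local_decay e0.
have L0 : 0 <= 2 * L by rewrite mulr_ge0// ltW.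
have := discrete_decay T_gt0 d0 L0 (fun x => sqr_ge0 _) Th0 Thadd step.
by move=> /le_trans; apply; rewrite lerD2l.
Qed.

End Solution.
Theorem proposition2 (R : realType) (P : ncProbSpace R) (W : R -> ncp_op P)
    (W_fbm : free_brownian_motion W)
    (k : nat) (alpha : ncp_op P -> ncp_op P)
    (beta gamma : 'I_k -> ncp_op P -> ncp_op P)
    (alpha_sa : forall A, ncp_sa A -> ncp_sa (alpha A))
    (beta_sa : forall i A, ncp_sa A -> ncp_sa (beta i A))
    (gamma_sa : forall i A, ncp_sa A -> ncp_sa (gamma i A))
    (alpha_filt : preserves_filtration W alpha)
    (beta_filt : forall i, preserves_filtration W (beta i))
    (gamma_filt : forall i, preserves_filtration W (gamma i))
    (Lbar : R) (Lbar_gt0 : 0 < Lbar)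
    (dissipative : forall A, ncp_sa A ->
      complex.Re (ncp_trace (A \o alpha A)) +
        k%:R / 2 * \sum_(i < k) norm2 (beta i A) ^+ 2 * norm2 (gamma i A) ^+ 2
      <= - Lbar * norm2 A ^+ 2)
    (U : R -> ncp_op P)
    (U_sol : free_sde_solution W alpha beta gamma U) :
  exists C' : R, 0 < C' /\
    forall t : R, 0 <= t ->
      norm2 (U t) ^+ 2 <= expR (- C' * t) * norm2 (U 0) ^+ 2.
Proof.
exists (2 * Lbar); split; first by rewrite mulr_gt0.
move=> t; rewrite le_eqVlt => /predU1P[<-|t0].
  by rewrite mulr0 expR0 mul1r.
exact: (solution_decay W_fbm alpha_sa beta_filt gamma_filt Lbar_gt0 dissipative U_sol t0).
Qed.
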